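(* Let $(\Omega,\mathcal F,P)$ be a probability space, $m\ge 0$ an integer, $\Theta\subseteq\mathbb R^m$, and for each $T\ge1$ let $\{\epsilon_{i,T}(\gamma):1\le i\le T\}$, $\gamma\in\Theta$, be random variables. Let $h=h_T>0$ be a deterministic sequence with $h\to0$ and $Th\to\infty$, let $K:\mathbb R\to\mathbb R$, $K_h(u)=K(u/h)/h$, fix an integer $j\ge0$ and set $$\hat\Psi(x,\gamma)=T^{-1}\sum_{i=1}^T\epsilon_{i,T}(\gamma)K_h(i/T-x)\Big(\frac{i/T-x}{h}\Big)^j,\qquad x\in[0,1],\ \gamma\in\Theta.$$ Assume (A.1), (A.2), (A.3) (defined in the context) hold, with $s>2$. Fix $c>0$ and define $$\theta=\frac{\beta(s-2)-m(s-1)(1+2c)-2s+1}{\beta s+m(s-1)+1}.$$ Let $d_T=T^r$ with $r=\min\{c,(1-\theta)/(2\lambda)\}$ and $\Theta_T=\{\gamma\in\mathbb R^m:\|\gamma\|\le d_T\}$. Suppose that $$\beta>\frac{m(s-1)(1+2c)+2s-1}{s-2}\qquad\text{and}\qquad \frac{\ln T}{T^\theta h}\to0 \ (T\to\infty).$$ If in addition there is a constant $C>0$ such that $$\sup_{T\ge1}\sup_{1\le i\le T}E\Big(\sup_{\gamma\in\Theta_T}|\epsilon_{i,T}(\gamma)|^s\Big)\le C(1+d_T^\lambda),\qquad \sup_{T\ge1}\sup_{1\le i\le T}E\Big(\sup_{\gamma\in\Theta_T}|\xi_{i,T}(\gamma)|^s\Big)\le C(1+d_T^\lambda),$$ then $$\sup_{\gamma\in\Theta_T}\sup_{x\in[0,1]}\big|\hat\Psi(x,\gamma)-E\hat\Psi(x,\gamma)\big|=O_p\Big(d_T^\lambda\sqrt{\tfrac{\ln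 T}{Th}}\Big).$$
   Context: Mixing coefficients: for $T\ge1$, $\gamma\in\Theta$, $0\le k<T$, $\alpha_{\gamma,T}(k)=\sup_{1\le l\le T-k}\sup\{|P(A\cap B)-P(A)P(B)|: B\in\mathcal F_{T,1}^l(\gamma),A\in\mathcal F_{T,l+k}^T(\gamma)\}$, where $\mathcal F_{T,i}^l(\gamma)=\sigma(\epsilon_{r,T}(\gamma): i\le r\le l)$; by convention $\alpha_{\gamma,T}(k)=1/4$ for $k\le0$ and $\alpha_{\gamma,T}(k)=0$ for $k\ge T$. (A.1) There are finite constants $A>0$ and $\beta>2$, not depending on $i,\gamma,T$, with $\alpha_{\gamma,T}(i)\le A i^{-\beta}$ for all $i\ge1$, $T$, $\gamma$. (A.2) $|K(u)|\le\bar K<\infty$ and $\int_{\mathbb R}|K(u)|^sdu\le\bar\mu<\infty$ for some $s>2$; there are constants $1\le\Lambda_1,L_1<\infty$ with $K(u)=0$ for $|u|>L_1$ and $|K(u)-K(u')|\le\Lambda_1|u-u'|$ for all $u,u'\in\mathbb R$. (A.3) For each $T\ge1$ and $1\le i\le T$ there is a nonnegative random function $\xi_{i,T}(\gamma)$ such that almost surely $|\epsilon_{i,T}(\gamma')-\epsilon_{i,T}(\gamma)|\le\xi_{i,T}(\gamma)\|\gamma'-\gamma\|$ for all $\gamma,\gamma'\in\Theta$ with $\|\gamma'-\gamma\|\le h$; and there are finite constants $s>2$, $\lambda\ge0$, $\bar C_1,\bar C_2>0$ with $\sup_{T\ge1}\sup_{1\le i\le T}E|\epsilon_{i,T}(\gamma)|^s\le\bar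 C_1(1+\|\gamma\|^\lambda)$ and $\sup_{T\ge1}\sup_{1\le i\le T}E|\xi_{i,T}(\gamma)|^s\le\bar C_2(1+\|\gamma\|^\lambda)$ for all $\gamma\in\Theta$. (The exponent $s$ is the same throughout.) $\|\cdot\|$ is the Euclidean norm. If $\lambda=0$, $(1-\theta)/(2\lambda)$ is read as $+\infty$, so $r=c$. Suprema over $\gamma\in\Theta_T$ range over $\gamma\in\Theta$ with $\|\gamma\|\le d_T$. $X_T=O_p(a_T)$ means: for every $\delta>0$ there is $M<\infty$ with $P(|X_T|>Ma_T)\le\delta$ for all sufficiently large $T$. *)

(* Defs.v *)
From HB Require Import structures.
From mathcomp Require Import all_boot all_order all_algebra.
From mathcomp Require Import all_classical all_reals all_analysis measurable_realfun.
Set Implicit Arguments. Unset Strict Implicit. Unset Printing Implicit Defensive.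
Import Order.TTheory GRing.Theory Num.Theory.
Import numFieldNormedType.Exports.
Local Open Scope classical_set_scope.
Local Open Scope ring_scope.

Section Defs.
Context {R : realType} {d : measure_display} {Omega : measurableType d}.

Definition enorm (m : nat) (v : 'rV[R]_m) : R :=
  Num.sqrt (\sum_(k < m) (v ord0 k) ^+ 2).

Definition sigmaF (m : nat) (eps : nat -> nat -> 'rV[R]_m -> Omega -> R)
  (T : nat) (g : 'rV[R]_m) (i l : nat) : set (set Omega) :=
  <<s [set A | exists r, (i <= r <= l)%N /\
        exists B : set R, measurable B /\ A = eps T r g @^-1` B] >>.

Definition mixing_coef (P : probability Omega R) (m : nat)
  (eps : nat -> nat -> 'rV[R]_m -> Omega -> R) (T : nat) (g : 'rV[R]_m)
  (k : nat) : R :=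
  if k == 0%N then 4^-1 else if (T <= k)%N then 0 else
  sup [set z | exists l, (1 <= l <= T - k)%N /\
        exists B A, sigmaF eps T g 1 l B /\ sigmaF eps T g (l + k) T A /\
        z = `| fine (P (A `&` B)) - fine (P A) * fine (P B) | ].

Definition outerP (P : probability Omega R) (E : set Omega) : \bar R :=
  ereal_inf [set P A | A in [set A | measurable A /\ E `<=` A]].

Definition outerE (P : probability Omega R) (f : Omega -> \bar R) : \bar R :=
  ereal_inf [set (\int[P]_w g w)%E | g in
    [set g : Omega -> \bar R | measurable_fun setT g /\ forall w, (f w <= g w)%E]].

Definition Psi_hat (m : nat) (eps : nat -> nat -> 'rV[R]_m -> Omega -> R)
  (K : R -> R) (h : nat -> R) (j T : nat) (x : R) (g : 'rV[R]_m) (w : Omega) : R :=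
  (T%:R)^-1 * \sum_(1 <= i < T.+1)
     eps T i g w * (K ((i%:R / T%:R - x) / h T) / h T)
       * ((i%:R / T%:R - x) / h T) ^+ j.

Definition EPsi_hat (P : probability Omega R) (m : nat)
  (eps : nat -> nat -> 'rV[R]_m -> Omega -> R)
  (K : R -> R) (h : nat -> R) (j T : nat) (x : R) (g : 'rV[R]_m) : R :=
  fine (\int[P]_w (Psi_hat eps K h j T x g w)%:E).

End Defs.

Definition theta_of {R : realType} (beta : R) (m : nat) (s c : R) : R :=
  (beta * (s - 2) - m%:R * (s - 1) * (1 + 2 * c) - 2 * s + 1)
  / (beta * s + m%:R * (s - 1) + 1).

Definition r_of {R : realType} (theta lam c : R) : R :=
  if lam == 0 then c else Num.min c ((1 - theta) / (2 * lam)).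

(* Main.v *)
(** Writing c_i(x) = K(u) u^j with u = (i/T - x)/h, the deviation is
    (Th)^-1 * sum_i c_i(x) (eps_i(gamma) - E eps_i(gamma)).
    Put a = sqrt(ln T / (Th)), H = 1/(ha), tau = H^(1/(s-1)), nu = 1/(a tau).
    Replacing gamma by the nearest point of a grid of mesh ha costs
    O(a) T^-1 sum_i xi_i, and truncating eps_i at tau costs
    a T^-1 sum_i |eps_i|^s because tau^(1-s) = ha; by the moment bounds on the
    suprema both are O_p(a d_T^lambda) uniformly in (x, gamma).
    Replacing x by a grid point costs a times a local average of the truncated
    |eps_i|, which is controlled like the main term.
    At a grid point only O(Th) indices matter.  They are cut into alternating
    blocks of length about nu, and a Bernstein inequality for weakly dependent
    blocks gives a tail T^(-C) + O(Th nu^(-1-beta)).  Multiplied by the number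
    O(d_T^m H^(m+1)) of grid points, the mixing term is at most a positive power
    of ln T / (T^theta h): theta is exactly the exponent for which the powers of
    T cancel.

    The Bernstein inequality needs no coupling and no conditional expectation:
    with S_k the partial sums of the blocks, the truncated exponential
    min(1, exp(lam (S_k - t) + 2 lam^2 v (q - k))) is bounded by 1, so each step
    of the usual supermartingale argument costs one covariance of bounded
    functions, hence a multiple of the mixing coefficient. *)
Require Import Defs.
From HB Require Import structures.
From mathcomp Require Import all_boot all_order all_algebra.
From mathcomp Require Import all_classical all_reals all_analysis measurable_realfun.
From mathcomp Require Import ring lra.
Set Implicit Arguments.
Unset Strict Implicit.
Unset Printing Implicit Defensive.
Import Order.TTheory GRing.Theory Num.Theory.
Import numFieldNormedType.Exports.
Local Open Scope classical_set_scope.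
Local Open Scope ring_scope.

(** * Expectation and probability *)

(** The block length [nu] is where two demands meet. A block of n truncated terms is bounded by a
    multiple of n tau, so the Laplace parameter is at most of order 1/(n tau). As long as n is at
    most 1/(a tau), this is at least of order a, and a deviation of order a T h then has an exponent
    of order a^2 T h = ln T. Shorter blocks would only enlarge the mixing error. The variance must
    not see the growing level tau: the covariances have to be summable in the lag, with constants
    that depend on s-th moments alone, and beta (s - 2) >= 3 s / 2 provides this. Moments of order
    d_T^lambda enter the variance bound squared; they cancel when the Laplace parameter is scaled by
    d_T^(-lambda) and the deviation by d_T^lambda. The cut-off at tau is discontinuous, so gamma is
    moved to the grid before truncation and never after. Suprema over gamma may fail to be
    measurable, so the bad event is covered by measurable sets that do not depend on gamma, and only
    their union is estimated. *)

Section expectation.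
Context {R : realType} {d : measure_display} {Omega : measurableType d}.
Variable P : probability Omega R.
Implicit Types f g X Y : Omega -> R.
Local Notation E f := (\int[P]_w f w)%R.

Definition L1 f := P.-integrable setT (EFin \o f).

Lemma L1_measurable f : L1 f -> measurable_fun setT f.
Proof. by move=> /measurable_int/measurable_EFinP. Qed.

Lemma L1_cst (r : R) : L1 (fun=> r).
Proof. exact: finite_measure_integrable_cst. Qed.

Lemma L1_le f g : measurable_fun setT f -> (forall w, `|f w| <= g w) -> L1 g -> L1 f.
Proof.
move=> mf fg; apply: le_integrable => //; first exact/measurable_EFinP.
by move=> w _; rewrite /= lee_fin (le_trans (fg w))// ler_norm.
Qed.

Lemma L1_bounded f M : measurable_fun setT f -> (forall w, `|f w| <= M) -> L1 f.
Proof. by move=> mf fM; apply: (@L1_le _ (fun=> M)) => //; exact: L1_cst. Qed.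

Lemma L1D f g : L1 f -> L1 g -> L1 (fun w => f w + g w).
Proof. by move=> lf lg; have := integrableD measurableT lf lg. Qed.

Lemma L1Z (k : R) f : L1 f -> L1 (fun w => k * f w).
Proof. by move=> lf; have := integrableZl measurableT k lf. Qed.

Lemma L1N f : L1 f -> L1 (fun w => - f w).
Proof. by move=> lf; have := integrableN lf. Qed.

Lemma L1B f g : L1 f -> L1 g -> L1 (fun w => f w - g w).
Proof. by move=> lf lg; apply: L1D => //; exact: L1N. Qed.

Lemma L1_abs f : L1 f -> L1 (fun w => `|f w|).
Proof. by move=> lf; have := integrable_abse lf. Qed.

Lemma L1_sum I (r : seq I) (Q : pred I) (F : I -> Omega -> R) :
  (forall i, L1 (F i)) -> L1 (fun w => \sum_(i <- r | Q i) F i w).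
Proof.
move=> lF; elim: r => [|i r IH].
  rewrite (_ : (fun w => _) = (fun=> 0)); first exact: L1_cst.
  by apply/funext => w; rewrite big_nil.
rewrite (_ : (fun w => _) = (fun w => (if Q i then F i w else 0) +
   \sum_(i <- r | Q i) F i w)).
  by apply: L1D => //; case: (Q i) => //; exact: L1_cst.
by apply/funext => w; rewrite big_cons; case: ifP; rewrite ?add0r.
Qed.

Lemma eqE f g : f =1 g -> E f = E g.
Proof. by move=> fg; apply: eq_Rintegral => w _. Qed.

Lemma ED f g : L1 f -> L1 g -> E (fun w => f w + g w) = E f + E g.
Proof. by move=> lf lg; exact: RintegralD. Qed.

Lemma EB f g : L1 f -> L1 g -> E (fun w => f w - g w) = E f - E g.
Proof. by move=> lf lg; exact: RintegralB. Qed.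

Lemma EZ (k : R) f : L1 f -> E (fun w => k * f w) = k * E f.
Proof. by move=> lf; exact: RintegralZl. Qed.

Lemma E_cst (r : R) : E (fun=> r) = r.
Proof.
by rewrite Rintegral_cst// (_ : fine _ = 1) ?mulr1// -[RHS]/(fine 1%E) -(probability_setT P).
Qed.

Lemma E_le f g : L1 f -> L1 g -> (forall w, f w <= g w) -> E f <= E g.
Proof. by move=> lf lg fg; apply: le_Rintegral. Qed.

Lemma E_ge0 f : (forall w, 0 <= f w) -> 0 <= E f.
Proof. by move=> f0; apply: Rintegral_ge0. Qed.

Lemma E_abs f : L1 f -> `|E f| <= E (fun w => `|f w|).
Proof. by move=> lf; apply: le_normr_Rintegral. Qed.

Lemma E_abs_le f g : L1 f -> L1 g -> (forall w, `|f w| <= g w) -> `|E f| <= E g.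
Proof. by move=> lf lg fg; apply: le_trans (E_abs lf) _; apply: E_le => //; exact: L1_abs. Qed.

Lemma E_abs_le_cst f M : measurable_fun setT f -> (forall w, `|f w| <= M) -> `|E f| <= M.
Proof.
move=> mf fM; rewrite -(E_cst M); apply: E_abs_le => //; last exact: L1_cst.
exact: L1_bounded fM.
Qed.

Lemma E_sum I (r : seq I) (Q : pred I) (F : I -> Omega -> R) :
  (forall i, L1 (F i)) ->
  E (fun w => \sum_(i <- r | Q i) F i w) = \sum_(i <- r | Q i) E (F i).
Proof.
move=> lF; elim: r => [|i r IH].
  by rewrite big_nil -[RHS]E_cst; apply: eqE => w; rewrite big_nil.
rewrite big_cons; case: ifPn => Qi.
  rewrite -IH -ED//; last exact: L1_sum.
  by apply: eqE => w; rewrite big_cons Qi.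
by rewrite -IH; apply: eqE => w; rewrite big_cons (negbTE Qi).
Qed.

Definition Pr (A : set Omega) : R := fine (P A).

Lemma E_indic A : measurable A -> E (fun w => \1_A w) = Pr A.
Proof. by move=> mA; rewrite /Rintegral /Pr integral_indic// setIT. Qed.

Lemma L1_indic A : measurable A -> L1 (fun w => \1_A w).
Proof.
move=> mA; apply: (@L1_bounded _ 1); first exact: measurable_indic.
by move=> w; rewrite indicE; case: (w \in A); rewrite ?normr1 ?normr0.
Qed.

Lemma PrE A : measurable A -> P A = (Pr A)%:E.
Proof. by move=> mA; rewrite fineK// fin_num_measure. Qed.

Lemma Pr_ge0 A : 0 <= Pr A.
Proof. exact: fine_ge0. Qed.

Lemma Pr_le1 A : measurable A -> Pr A <= 1.
Proof. by move=> mA; rewrite -lee_fin -PrE// probability_le1. Qed.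

Lemma Pr_le A B : measurable A -> measurable B -> A `<=` B -> Pr A <= Pr B.
Proof. by move=> mA mB AB; rewrite -lee_fin -!PrE// le_measure// inE. Qed.

Lemma PrU A B : measurable A -> measurable B -> Pr (A `|` B) <= Pr A + Pr B.
Proof.
move=> mA mB; rewrite -lee_fin EFinD -!PrE//; last exact: measurableU.
exact: measureU2.
Qed.

Lemma Pr_bigU I (r : seq I) (F : I -> set Omega) : (forall i, measurable (F i)) ->
  Pr (\big[setU/set0]_(i <- r) F i) <= \sum_(i <- r) Pr (F i).
Proof.
move=> mF; elim: r => [|i r IH]; first by rewrite !big_nil /Pr measure0.
rewrite !big_cons (le_trans (PrU _ _)) ?lerD2l//.
exact: bigsetU_measurable.
Qed.

Lemma markov_Pr f (r : R) : L1 f -> (forall w, 0 <= f w) -> 0 < r ->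
  r * Pr [set w | r <= f w] <= E f.
Proof.
move=> lf f0 r0; have mf := L1_measurable lf.
have mA : measurable [set w | r <= f w].
  by rewrite -[X in measurable X]setTI; exact: measurable_fun_le.
rewrite -E_indic// -EZ; last exact: L1_indic.
apply: E_le => //; first by apply: L1Z; exact: L1_indic.
move=> w; rewrite indicE; case: (boolP (w \in _)); rewrite ?mulr1 ?mulr0//.
by rewrite inE.
Qed.

End expectation.

(** * Covariances and the Bernstein inequality *)

Section dependence.
Context {R : realType} {d : measure_display} {Omega : measurableType d}.
Variable P : probability Omega R.
Local Notation E f := (\int[P]_w f w)%R.
Local Notation Pr := (Pr P).
Local Notation L1 := (L1 P).

(** An alpha-mixing bound between the sigma-fields of two real variables, stated on preimages so
    that the covariance estimates involve no sigma-field. *)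
Definition dep (X Y : Omega -> R) (alpha : R) := forall U V : set R,
  measurable U -> measurable V ->
  `|Pr (X @^-1` U `&` Y @^-1` V) - Pr (X @^-1` U) * Pr (Y @^-1` V)| <= alpha.

(** The sum counts the integers 1, ..., N up to [y], so it is the integer part of [y]; it serves as
    a discrete layer-cake formula. *)
Lemma count_ge (y : R) (N : nat) : 0 <= y <= N%:R ->
  y - 1 <= \sum_(i < N) (((i.+1)%:R <= y)%R)%:R <= y.
Proof.
elim: N => [|N IH] /andP[y0 yN].
  by rewrite big_ord0; apply/andP; split => //; lra.
rewrite big_ord_recr /=; case: (leP N%:R y) => [Ny|yN'].
  have -> : \sum_(i < N) (((i.+1)%:R <= y)%R)%:R = N%:R :> R.
    rewrite (eq_bigr (fun=> 1)) ?sumr_const ?card_ord// => i _.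
    by rewrite (le_trans _ Ny)// ler_nat.
  by case: (leP N.+1%:R y) => H; move: yN H; rewrite -natr1 /= => *; apply/andP; split; lra.
have -> : (N.+1%:R <= y) = false by apply/negbTE; rewrite -ltNge (lt_trans yN')// ltr_nat.
by rewrite addr0; apply: IH; rewrite y0 ltW.
Qed.

(* [f] and [g] are within 1/N of averages of N indicators of their superlevel
   sets, for which the bound is bilinear in the defining inequality of [dep]. *)
Lemma cov_unit X Y alpha (f g : R -> R) :
  measurable_fun setT X -> measurable_fun setT Y ->
  measurable_fun setT f -> measurable_fun setT g ->
  (forall x, 0 <= f x <= 1) -> (forall x, 0 <= g x <= 1) ->
  dep X Y alpha ->
  `|E (fun w => f (X w) * g (Y w)) - E (fun w => f (X w)) * E (fun w => g (Y w))| <= alpha.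
Proof.
move=> mX mY mf mg f01 g01 XY.
(* Rounding to multiples of 1/(N+1) costs 2/(N+1) in the mean of the product and as much in the
   product of the means. *)
suff H N : `|E (fun w => f (X w) * g (Y w)) - E (fun w => f (X w)) * E (fun w => g (Y w))|
    <= alpha + 4 / N.+1%:R.
  apply/ler_addgt0Pr => e e0.
  pose N := Num.truncn (4 / e); apply: (le_trans (H N)); rewrite lerD2l.
  rewrite ler_pdivrMr// mulrC -ler_pdivrMr//.
  exact/ltW/truncnS_gt.
pose A (h : R -> R) (i : nat) := [set x : R | i.+1%:R <= N.+1%:R * h x].
pose s (h : R -> R) x : R := N.+1%:R^-1 * \sum_(i < N.+1) \1_(A h i) x.
have N0 : 0 < N.+1%:R :> R by [].
have sP (h : R -> R) x : 0 <= h x <= 1 -> h x - N.+1%:R^-1 <= s h x <= h x.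
  move=> /andP[h0 h1]; have := @count_ge (N.+1%:R * h x) N.+1.
  rewrite mulr_ge0//= ler_piMr// => /(_ isT).
  rewrite /s; under [in X in _ -> X]eq_bigr do rewrite indicE mem_setE.
  set S := \sum_(i < _) _ => /andP[S1 S2]; apply/andP; split.
    by rewrite -(ler_pM2l N0) mulrBr mulrA divff ?mul1r ?gt_eqF.
  by rewrite ler_pdivrMl.
have mA (h : R -> R) i : measurable_fun setT h -> measurable (A h i).
  move=> mh; rewrite -[X in measurable X]setTI; apply: measurable_fun_le => //.
  exact: measurable_funM.
have mI (h : R -> R) (Z : Omega -> R) i : measurable_fun setT h -> measurable_fun setT Z ->
    measurable (Z @^-1` A h i).
  by move=> mh mZ; rewrite -[X in measurable X]setTI; apply: mZ => //; exact: mA.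
have Es (h : R -> R) (Z : Omega -> R) : measurable_fun setT h -> measurable_fun setT Z ->
    E (fun w => s h (Z w)) = N.+1%:R^-1 * \sum_(i < N.+1) Pr (Z @^-1` A h i).
  move=> mh mZ; rewrite EZ; last by apply: L1_sum => i; apply: L1_indic; exact: mI.
  rewrite E_sum => [|i]; last by apply: L1_indic; exact: mI.
  by congr (_ * _); apply: eq_bigr => i _; rewrite E_indic//; exact: mI.
have s01 (h : R -> R) x : 0 <= h x <= 1 -> 0 <= s h x <= 1.
  move=> hx; have /andP[_ sh] := sP h x hx; case/andP: hx => h0 h1.
  apply/andP; split; last exact: le_trans sh h1.
  apply: mulr_ge0; first by rewrite invr_ge0.
  by apply: sumr_ge0 => i _; rewrite indicE; case: (_ \in _).
have ms (h : R -> R) (Z : Omega -> R) : measurable_fun setT h -> measurable_fun setT Z ->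
    measurable_fun setT (fun w => s h (Z w)).
  move=> mh mZ; apply: measurable_funM => //; apply: measurable_sum => i.
  have -> : (fun w => \1_(A h i) (Z w)) = \1_(Z @^-1` A h i) :> (Omega -> R) by [].
  by apply: measurable_indic; exact: mI.
have mfX : measurable_fun setT (fun w => f (X w)) by exact: measurableT_comp.
have mgY : measurable_fun setT (fun w => g (Y w)) by exact: measurableT_comp.
have msf := ms _ _ mf mX; have msg := ms _ _ mg mY.
have B01 (u : R) : 0 <= u <= 1 -> `|u| <= 1 by case/andP => u0 u1; rewrite ger0_norm.
have l1 (h : Omega -> R) : measurable_fun setT h -> (forall w, 0 <= h w <= 1) -> L1 h.
  by move=> mh h01; apply: (@L1_bounded _ _ _ _ _ 1) => // w; exact: B01.
have M01 (u v : R) : 0 <= u <= 1 -> 0 <= v <= 1 -> 0 <= u * v <= 1.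
  by move=> /andP[? ?] /andP[? ?]; rewrite mulr_ge0//= mulr_ile1.
have ndN : N.+1%:R^-1 * \sum_(i < N.+1) alpha = alpha.
  by rewrite sumr_const card_ord -[alpha *+ _]mulr_natr mulrCA mulVf ?mulr1// gt_eqF.
have sfg : `|E (fun w => s f (X w) * s g (Y w)) - E (fun w => s f (X w)) * E (fun w => s g (Y w))| <= alpha.
  rewrite !Es//.
  have mXY i k : measurable (X @^-1` A f i `&` Y @^-1` A g k).
    by apply: measurableI; exact: mI.
  have -> : E (fun w => s f (X w) * s g (Y w)) = N.+1%:R^-1 * (N.+1%:R^-1 *
     \sum_(i < N.+1) \sum_(k < N.+1) Pr (X @^-1` A f i `&` Y @^-1` A g k)).
    have -> : \sum_(i < N.+1) \sum_(k < N.+1) Pr (X @^-1` A f i `&` Y @^-1` A g k) =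
       E (fun w => \sum_(i < N.+1) \sum_(k < N.+1) \1_(X @^-1` A f i `&` Y @^-1` A g k) w).
      rewrite E_sum => [|i]; last by apply: L1_sum => k; apply: L1_indic.
      apply: eq_bigr => i _; rewrite E_sum => [|k]; last exact: L1_indic.
      by apply: eq_bigr => k _; rewrite E_indic.
    have l i : L1 (fun w => \sum_(k < N.+1) \1_(X @^-1` A f i `&` Y @^-1` A g k) w).
      by apply: L1_sum => k; exact: L1_indic.
    rewrite -EZ; last exact: L1_sum.
    rewrite -EZ; last by apply/L1Z/L1_sum.
    apply: eqE => w; rewrite /s mulrACA [RHS]mulrA; congr (_ * _).
    rewrite big_distrlr/=; apply: eq_bigr => i _; apply: eq_bigr => k _.
    by rewrite indicI.
  rewrite mulrACA -mulrA -mulrBr big_distrlr/= -mulrBr -sumrB.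
  have e : `|N.+1%:R^-1| = N.+1%:R^-1 :> R by rewrite ger0_norm ?invr_ge0.
  rewrite normrM e normrM e.
  rewrite -[leRHS]ndN -[X in \sum_(i < N.+1) X]ndN -mulr_sumr.
  rewrite ler_pM2l ?invr_gt0// ler_pM2l ?invr_gt0//.
  apply: le_trans (ler_norm_sum _ _ _) _; apply: ler_sum => i _; rewrite -sumrB.
  apply: le_trans (ler_norm_sum _ _ _) _; apply: ler_sum => k _.
  by apply: XY; exact: mA.
have dN (x y x' y' : R) : 0 <= x <= 1 -> 0 <= y' <= 1 ->
    x - N.+1%:R^-1 <= x' <= x -> y - N.+1%:R^-1 <= y' <= y -> `|x * y - x' * y'| <= 2 / N.+1%:R.
  set n := N.+1%:R^-1 => /andP[? ?] /andP[? ?] /andP[? ?] /andP[? ?].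
  rewrite (_ : x * y - x' * y' = x * (y - y') + y' * (x - x')); last by ring.
  by rewrite ler_norml; apply/andP; split; nra.
have H1 : `|E (fun w => f (X w) * g (Y w)) - E (fun w => s f (X w) * s g (Y w))| <= 2 / N.+1%:R.
  rewrite -EB; try by apply: l1 => [|w]; [exact: measurable_funM|apply: M01; auto].
  apply: E_abs_le_cst => [|w]; first by apply: measurable_funB; exact: measurable_funM.
  by apply: dN; auto.
have EsP (h : R -> R) (Z : Omega -> R) : measurable_fun setT h -> measurable_fun setT Z ->
    (forall x, 0 <= h x <= 1) -> measurable_fun setT (fun w => h (Z w)) ->
  [/\ 0 <= E (fun w => h (Z w)) <= 1, 0 <= E (fun w => s h (Z w)) <= 1 &
  E (fun w => h (Z w)) - N.+1%:R^-1 <= E (fun w => s h (Z w)) <= E (fun w => h (Z w))].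
  move=> mh mZ h01 mhZ; have msh := ms _ _ mh mZ.
  have Lh : L1 (fun w => h (Z w)) by exact: l1.
  have Ls : L1 (fun w => s h (Z w)) by apply: l1; auto.
  have C := @L1_cst _ _ _ P.
  split.
  - rewrite -(E_cst P 1); apply/andP; split; first by apply: E_ge0 => w; case/andP: (h01 (Z w)).
    by apply: E_le => // w; case/andP: (h01 (Z w)).
  - rewrite -(E_cst P 1); apply/andP; split; first by apply: E_ge0 => w; case/andP: (s01 h (Z w) (h01 _)).
    by apply: E_le => // w; case/andP: (s01 h (Z w) (h01 _)).
  - rewrite -(E_cst P N.+1%:R^-1) -EB//; apply/andP; split; apply: E_le => //.
    + exact: L1B.
    + by move=> w; case/andP: (sP h (Z w) (h01 _)).
    + by move=> w; case/andP: (sP h (Z w) (h01 _)).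
have [fa fb fc] := EsP _ _ mf mX f01 mfX.
have [ga gb gc] := EsP _ _ mg mY g01 mgY.
have H2 := dN _ _ _ _ fa gb fc gc.
rewrite (_ : 4 / _ = 2 / N.+1%:R + 2 / N.+1%:R); last by rewrite -mulrDl; congr (_ / _); ring.
apply: le_trans (ler_distD (E (fun w => s f (X w) * s g (Y w))) _ _) _.
rewrite addrCA lerD//.
apply: le_trans (ler_distD (E (fun w => s f (X w)) * E (fun w => s g (Y w))) _ _) _.
by rewrite lerD// distrC.
Qed.

(** An affine map takes [g] into [0, 1]; the shift drops out of the covariance and the scale 2 B
    comes out as a factor. Only [g] is rescaled, since the truncated exponential already has weights
    in [0, 1]. *)
Lemma cov_unit_bounded X Y alpha B (f g : R -> R) :
  measurable_fun setT X -> measurable_fun setT Y ->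
  measurable_fun setT f -> measurable_fun setT g ->
  (forall x, 0 <= f x <= 1) -> 0 < B -> (forall x, `|g x| <= B) ->
  dep X Y alpha ->
  `|E (fun w => f (X w) * g (Y w)) - E (fun w => f (X w)) * E (fun w => g (Y w))| <= 2 * B * alpha.
Proof.
move=> mX mY mf mg f01 B0 gB XY.
pose g' x := (2 * B)^-1 * (g x + B).
have g01 x : 0 <= g' x <= 1.
  move: (gB x); rewrite ler_norml /g' => /andP[? ?]; apply/andP; split.
    by rewrite mulr_ge0 ?invr_ge0; lra.
  by rewrite ler_pdivrMl; lra.
have mg' : measurable_fun setT g'.
  by apply: measurable_funM => //; exact: measurable_funD.
have mfX : measurable_fun setT (fun w => f (X w)) by exact: measurableT_comp.
have mgY : measurable_fun setT (fun w => g (Y w)) by exact: measurableT_comp.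
have fB x : `|f x| <= 1 by case/andP: (f01 x) => ? ?; rewrite ger0_norm.
have LfX : L1 (fun w => f (X w)) by exact: (@L1_bounded _ _ _ _ _ 1).
have LgY : L1 (fun w => g (Y w)) by exact: (@L1_bounded _ _ _ _ _ B).
have LfgX : L1 (fun w => f (X w) * g (Y w)).
  apply: (@L1_bounded _ _ _ _ _ B) => [|w]; first exact: measurable_funM.
  by rewrite normrM -[B]mul1r ler_pM.
have := cov_unit mX mY mf mg' f01 g01 XY; rewrite /g'.
have -> : E (fun w => (2 * B)^-1 * (g (Y w) + B)) = (2 * B)^-1 * (E (fun w => g (Y w)) + B).
  by rewrite EZ ?ED ?E_cst//; [exact: L1_cst|apply: L1D => //; exact: L1_cst].
have -> : E (fun w => f (X w) * ((2 * B)^-1 * (g (Y w) + B))) =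
    (2 * B)^-1 * (E (fun w => f (X w) * g (Y w)) + B * E (fun w => f (X w))).
  rewrite -EZ// -ED//; last exact: L1Z.
  rewrite -EZ; last by apply: L1D => //; exact: L1Z.
  by apply: eqE => w; ring.
rewrite (_ : (2 * B)^-1 * _ - _ = (2 * B)^-1 *
  (E (fun w => f (X w) * g (Y w)) - E (fun w => f (X w)) * E (fun w => g (Y w)))); last by ring.
rewrite normrM ger0_norm ?invr_ge0; last by lra.
by rewrite ler_pdivrMl//; lra.
Qed.

Lemma cov_bounded X Y alpha A B (f g : R -> R) :
  measurable_fun setT X -> measurable_fun setT Y ->
  measurable_fun setT f -> measurable_fun setT g ->
  0 < A -> (forall x, `|f x| <= A) -> 0 < B -> (forall x, `|g x| <= B) ->
  dep X Y alpha ->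
  `|E (fun w => f (X w) * g (Y w)) - E (fun w => f (X w)) * E (fun w => g (Y w))| <= 4 * A * B * alpha.
Proof.
move=> mX mY mf mg A0 fA B0 gB XY.
pose f' x := (2 * A)^-1 * (f x + A).
have f01 x : 0 <= f' x <= 1.
  move: (fA x); rewrite ler_norml /f' => /andP[? ?]; apply/andP; split.
    by rewrite mulr_ge0 ?invr_ge0; lra.
  by rewrite ler_pdivrMl; lra.
have mf' : measurable_fun setT f'.
  by apply: measurable_funM => //; exact: measurable_funD.
have mfX : measurable_fun setT (fun w => f (X w)) by exact: measurableT_comp.
have mgY : measurable_fun setT (fun w => g (Y w)) by exact: measurableT_comp.
have LfX : L1 (fun w => f (X w)) by exact: (@L1_bounded _ _ _ _ _ A).
have LgY : L1 (fun w => g (Y w)) by exact: (@L1_bounded _ _ _ _ _ B).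
have LfgX : L1 (fun w => f (X w) * g (Y w)).
  apply: (@L1_bounded _ _ _ _ _ (A * B)) => [|w]; first exact: measurable_funM.
  by rewrite normrM ler_pM.
have := cov_unit_bounded mX mY mf' mg f01 B0 gB XY; rewrite /f'.
have -> : E (fun w => (2 * A)^-1 * (f (X w) + A)) = (2 * A)^-1 * (E (fun w => f (X w)) + A).
  by rewrite EZ ?ED ?E_cst//; [exact: L1_cst|apply: L1D => //; exact: L1_cst].
have -> : E (fun w => (2 * A)^-1 * (f (X w) + A) * g (Y w)) =
    (2 * A)^-1 * (E (fun w => f (X w) * g (Y w)) + A * E (fun w => g (Y w))).
  rewrite -EZ// -ED//; last exact: L1Z.
  rewrite -EZ; last by apply: L1D => //; exact: L1Z.
  by apply: eqE => w; ring.
rewrite (_ : (2 * A)^-1 * _ - _ = (2 * A)^-1 *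
  (E (fun w => f (X w) * g (Y w)) - E (fun w => f (X w)) * E (fun w => g (Y w)))); last by ring.
rewrite normrM ger0_norm ?invr_ge0; last by lra.
rewrite ler_pdivrMl//; lra.
Qed.

End dependence.

(** * Exponential inequality for weakly dependent variables *)

Section bernstein.
Context {R : realType} {d : measure_display} {Omega : measurableType d}.
Variable P : probability Omega R.
Local Notation E f := (\int[P]_w f w)%R.
Local Notation Pr := (Pr P).
Local Notation L1 := (L1 P).

(** exp(y) is at most 1/(1 - y) = 1 + y + y^2/(1 - y), and 1 - y is at least 1/2. *)
Lemma expR_le_quadratic (y : R) : y <= 2^-1 -> expR y <= 1 + y + 2 * y ^+ 2.
Proof.
move=> y2; have H : 1 - y <= expR (- y) by rewrite expR_ge1Dx.
have p : 0 < 1 - y by lra.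
have : expR y * (1 - y) <= 1.
  by rewrite -ler_pdivlMl ?expR_gt0// mulr1 -expRN.
by have := expR_gt0 y; nra.
Qed.

Lemma measurable_sum_ord (n : nat) (Y : nat -> Omega -> R) :
  (forall k, measurable_fun setT (Y k)) ->
  measurable_fun setT (fun w => \sum_(i < n) Y i w).
Proof. by move=> mY; apply: measurable_sum => i. Qed.

(** The truncated exponential depends on the past only through the partial sum, so dependence
    between that one real variable and the next term suffices. Each step costs 2 [alpha], the
    covariance bound for a function in [0, 1] against one in [-1, 1]. The drift 2 lam^2 v (q - k)
    pays in advance for the variances still to come. *)
Lemma bernstein_dep (Y : nat -> Omega -> R) (B v lam alpha t : R) (q : nat) :
  (forall k, measurable_fun setT (Y k)) ->
  (forall k w, `|Y k w| <= B) ->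
  (forall k, E (Y k) = 0) ->
  (forall k, E (fun w => Y k w ^+ 2) <= v) ->
  0 < lam -> 0 <= B -> lam * B <= 2^-1 ->
  (forall k, (k < q)%N -> dep P (fun w => \sum_(i < k) Y i w) (Y k) alpha) ->
  Pr [set w | t <= \sum_(i < q) Y i w] <=
    expR (- lam * t + 2 * lam ^+ 2 * v * q%:R) + 2 * q%:R * alpha.
Proof.
move=> mY YB EY0 EY2 lam0 B0 lamB Ydep.
(* [psi k (S k)] is the truncated exponential; where [e k x > 1] the bound
   [psi k.+1 <= 1 = psi k] replaces the exponential estimate. *)
pose e (k : nat) x : R := expR (lam * (x - t) + 2 * lam ^+ 2 * v * (q%:R - k%:R)).
pose psi k x : R := Num.min 1 (e k x).
pose S k w := \sum_(i < k) Y i w.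
have mS k : measurable_fun setT (S k) by exact: measurable_sum_ord.
have me k : measurable_fun setT (e k).
  apply: measurableT_comp => //; apply: measurable_funD => //.
  by apply: measurable_funM => //; apply: measurable_funB.
have mpsi k : measurable_fun setT (psi k) by exact: measurable_minr.
have mpsiS k : measurable_fun setT (fun w => psi k (S k w)) by exact: measurableT_comp.
have psi01 k x : 0 <= psi k x <= 1.
  by rewrite /psi le_min ler01 expR_ge0 ge_min lexx.
(* Clamping to [-B, B] leaves every value of [Y] unchanged and makes [g] bounded on the whole line,
   as the covariance bound requires. *)
pose c x := Num.max (- B) (Num.min B x).
have mc : measurable_fun setT c by apply: measurable_maxr => //; exact: measurable_minr.
have cB x : `|c x| <= B.
  by rewrite ler_norml /c le_max lexx/= ge_max ge_min lexx orTb andbT; lra.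
have cY k w : c (Y k w) = Y k w.
  move: (YB k w); rewrite ler_norml => /andP[? ?].
  by rewrite /c min_r// max_r.
pose g x := lam * c x + 2 * lam ^+ 2 * c x ^+ 2.
have mg : measurable_fun setT g.
  by apply: measurable_funD; apply: measurable_funM => //; exact: measurable_funX.
have lc x : `|lam * c x| <= 2^-1.
  by rewrite normrM gtr0_norm//; apply: le_trans lamB; rewrite ler_pM2l.
have gB x : `|g x| <= 1.
  rewrite /g -mulrA -exprMn; move: (lc x); set y := lam * c x.
  by rewrite !ler_norml => /andP[? ?]; apply/andP; split; nra.
have ee k x : e k x = e k.+1 x * expR (2 * lam ^+ 2 * v).
  by rewrite /e -expRD; congr expR; rewrite -natr1; ring.
have v0 : 0 <= v.
  by apply: le_trans (EY2 0%N); apply: E_ge0 => w; exact: sqr_ge0.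
have step k : (k < q)%N -> E (fun w => psi k.+1 (S k.+1 w)) <=
    E (fun w => psi k (S k w)) + 2 * alpha.
  move=> kq.
  (* [f] carries the part that the next factor multiplies, [r] the part already stopped at 1. [f]
     stays below 1 because the drift decreases in [k]. *)
  pose f x := if e k x <= 1 then e k.+1 x else 0.
  pose r x : R := if e k x <= 1 then 0 else 1.
  have mle : measurable_fun setT (fun x => e k x <= 1) by exact: measurable_fun_ler.
  have mf : measurable_fun setT f by exact: measurable_fun_ifT.
  have mr : measurable_fun setT r by exact: measurable_fun_ifT.
  have f01 x : 0 <= f x <= 1.
    rewrite /f; case: ifPn => [|_]; last by rewrite lexx ler01.
    rewrite expR_ge0/= ee; apply: le_trans.
    rewrite ler_peMr ?expR_ge0// -[leLHS]expR0 ler_expR.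
    by rewrite mulr_ge0// mulr_ge0// sqr_ge0.
  have r01 x : 0 <= r x <= 1 by rewrite /r; case: ifP; rewrite ?lexx ?ler01.
  have psiE x : psi k x = f x * expR (2 * lam ^+ 2 * v) + r x.
    rewrite /psi /f /r; case: ifPn => [e1|]; first by rewrite -ee addr0 min_r.
    by rewrite -ltNge => /ltW e1; rewrite min_l// mul0r add0r.
  have key w : psi k.+1 (S k.+1 w) <= f (S k w) + f (S k w) * g (Y k w) + r (S k w).
    rewrite /S big_ord_recr/= -/(S k w) /f /r; set x := S k w; set y := Y k w.
    case: ifPn => [e1|_]; last by rewrite mul0r !add0r; case/andP: (psi01 k.+1 (x + y)).
    rewrite addr0 /psi ge_min; apply/orP; right.
    rewrite (_ : e k.+1 x + _ = e k.+1 x * (1 + g (Y k w))); last by rewrite [RHS]mulrDr mulr1.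
    rewrite /g cY.
    have -> : e k.+1 (x + y) = e k.+1 x * expR (lam * y).
      by rewrite /e -expRD; congr expR; ring.
    rewrite ler_pM2l ?expR_gt0//; apply: le_trans (expR_le_quadratic _) _.
      by move: (lc (Y k w)); rewrite cY ler_norml => /andP[].
    by rewrite -/y exprMn; lra.
  have B01 (u : R) : 0 <= u <= 1 -> `|u| <= 1 by case/andP => u0 u1; rewrite ger0_norm.
  have l1 (u : R -> R) (Z : Omega -> R) : measurable_fun setT u -> measurable_fun setT Z ->
      (forall w, `|u w| <= 1) -> L1 (fun w => u (Z w)).
    by move=> mu mZ u01; apply: (@L1_bounded _ _ _ _ _ 1) => //; exact: measurableT_comp.
  have Lf : L1 (fun w => f (S k w)) by apply: l1 => // w; exact: B01.
  have Lr : L1 (fun w => r (S k w)) by apply: l1 => // w; exact: B01.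
  have Lg : L1 (fun w => g (Y k w)) by apply: l1 => // w; exact: B01.
  have Lfg : L1 (fun w => f (S k w) * g (Y k w)).
    apply: (@L1_bounded _ _ _ _ _ 1) => [|w].
      by apply: measurable_funM; exact: measurableT_comp.
    by rewrite normrM mulr_ile1//; exact: B01.
  have Lpsi : L1 (fun w => psi k.+1 (S k.+1 w)) by apply: l1 => // w; exact: B01.
  apply: (@le_trans _ _ (E (fun w => f (S k w) + f (S k w) * g (Y k w) + r (S k w)))).
    by apply: E_le => //; apply: L1D => //; exact: L1D.
  rewrite ED//; last exact: L1D.
  rewrite ED//.
  have -> : E (fun w => psi k (S k w)) = E (fun w => f (S k w)) * expR (2 * lam ^+ 2 * v) + E (fun w => r (S k w)).
    rewrite mulrC -EZ// -ED//; last exact: L1Z.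
    by apply: eqE => w; rewrite psiE mulrC.
  have := cov_unit_bounded (mS k) (mY k) mf mg f01 ltr01 gB (Ydep k kq).
  rewrite mulr1 ler_norml => /andP[_ H].
  have Eg : E (fun w => g (Y k w)) <= 2 * lam ^+ 2 * v.
    have LY : L1 (Y k) by exact: (@L1_bounded _ _ _ _ _ B).
    have LY2 : L1 (fun w => Y k w ^+ 2).
      apply: (@L1_bounded _ _ _ _ _ (B ^+ 2)) => [|w]; first exact: measurable_funX.
      by rewrite normrX lerXn2r// nnegrE.
    have -> : E (fun w => g (Y k w)) = E (fun w => lam * Y k w + 2 * lam ^+ 2 * Y k w ^+ 2).
      by apply: eqE => w; rewrite /g cY.
    rewrite ED; [|exact: L1Z|exact: L1Z].
    rewrite EZ// EZ// EY0 mulr0 add0r ler_wpM2l//.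
    by rewrite mulr_ge0// sqr_ge0.
  have Ef0 : 0 <= E (fun w => f (S k w)) by apply: E_ge0 => w; case/andP: (f01 (S k w)).
  have ev : 1 + E (fun w => g (Y k w)) <= expR (2 * lam ^+ 2 * v).
    by apply: le_trans (expR_ge1Dx _); rewrite lerD2l.
  have := ler_wpM2l Ef0 ev.
  by move: H; lra.
have all k : (k <= q)%N -> E (fun w => psi k (S k w)) <= psi 0%N 0 + 2 * k%:R * alpha.
  elim: k => [_|k IH kq].
    rewrite mulr0 mul0r addr0 -(E_cst P (psi 0%N 0)) le_eqVlt; apply/orP; left; apply/eqP.
    by apply: eqE => w; rewrite /S big_ord0.
  apply: le_trans (step _ kq) _; have := IH (ltnW kq).
  by rewrite -natr1; lra.
(* At k = q the drift is spent, so the deviation event is exactly that the truncated exponential has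
   reached 1. *)
have -> : [set w | t <= \sum_(i < q) Y i w] = [set w | 1 <= psi q (S q w)].
  apply/seteqP; split => w /=; rewrite /psi le_min lexx/= /e subrr mulr0 addr0.
    by move=> tS; rewrite -[leLHS]expR0 ler_expR mulr_ge0 ?(ltW lam0) ?subr_ge0.
  by rewrite -[X in X <= _]expR0 ler_expR pmulr_rge0// subr_ge0.
have Lq : L1 (fun w => psi q (S q w)).
  apply: (@L1_bounded _ _ _ _ _ 1) => // w.
  by case/andP: (psi01 q (S q w)) => ? ?; rewrite ger0_norm.
have := markov_Pr Lq (fun w => proj1 (andP (psi01 q (S q w)))) ltr01.
rewrite mul1r => /le_trans; apply; apply: le_trans (all q (leqnn q)) _.
rewrite lerD2r /psi ge_min; apply/orP; right; rewrite ler_expR.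
by rewrite subr0 add0r mulrN mulNr.
Qed.
End bernstein.

(** * Covariance bound from moments *)

Section covariance.
Context {R : realType} {d : measure_display} {Omega : measurableType d}.
Variable P : probability Omega R.
Local Notation E f := (\int[P]_w f w)%R.
Local Notation L1 := (L1 P).

Lemma powR_addp (a x y : R) : 0 < a -> a `^ (x + y) = a `^ x * a `^ y.
Proof. by move=> a0; rewrite powRD//; apply/implyP => _; rewrite gt_eqF. Qed.

Lemma powR_tail (M z p s : R) : 0 < M <= z -> p <= s -> z `^ p <= M `^ (p - s) * z `^ s.
Proof.
move=> /andP[M0 Mz] ps; have z0 : 0 < z by exact: lt_le_trans Mz.
rewrite (_ : z `^ s = z `^ p * z `^ (s - p)); last first.
  by rewrite -powR_addp// addrC subrK.
rewrite mulrCA ler_peMr ?powR_ge0//.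
rewrite (_ : M `^ (p - s) = (M `^ (s - p))^-1); last by rewrite -powRN opprB.
rewrite mulrC ler_pdivlMr ?powR_gt0// mul1r.
by rewrite ge0_ler_powR ?subr_ge0// nnegrE ltW.
Qed.

Lemma abs_le_1powR (x s : R) : 1 <= s -> `|x| <= 1 + `|x| `^ s.
Proof.
move=> s1; case: (leP `|x| 1) => x1; first by rewrite (le_trans x1)// lerDl powR_ge0.
apply: le_trans (_ : `|x| `^ s <= _); last by rewrite lerDr.
by rewrite -{1}[`|x|]powRr1// ler_powR// ltW.
Qed.

(** A covariance inequality of Davydov type: cutting both variables at [M] leaves a bounded
    covariance, and the discarded parts are of size M^(2 - s). The bound [b] gives integrability and
    stays out of the estimate, which matters because it will be a multiple of the growing truncation
    level. *)
Lemma cov_moment X Y alpha s M B b :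
  measurable_fun setT X -> measurable_fun setT Y -> dep P X Y alpha ->
  2 < s -> 1 <= M -> (forall w, `|X w| <= b) -> (forall w, `|Y w| <= b) ->
  E (fun w => `|X w| `^ s) <= B -> E (fun w => `|Y w| `^ s) <= B ->
  `|E (fun w => X w * Y w) - E X * E Y| <=
    4 * M ^+ 2 * alpha + 4 * M `^ (2 - s) * (1 + B) ^+ 2.
Proof.
move=> mX mY XY s2 M1 Xb Yb EX EY.
have M0 : 0 < M by exact: lt_le_trans M1.
pose t (x : R) := if `|x| <= M then x else 0.
have mt : measurable_fun setT t.
  by apply: measurable_fun_ifT => //; apply: measurable_fun_ler => //; exact: measurableT_comp.
have tM x : `|t x| <= M by rewrite /t; case: ifP => // _; rewrite normr0 ltW.
have tx x : `|t x| <= `|x| by rewrite /t; case: ifP => //; rewrite normr0.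
have tail1 x : `|x - t x| <= M `^ (1 - s) * `|x| `^ s.
  rewrite /t; case: ifPn => [_|]; first by rewrite subrr normr0 mulr_ge0 ?powR_ge0.
  rewrite -ltNge => /ltW xM; rewrite subr0 -{1}[`|x|]powRr1//.
  by apply: powR_tail; [rewrite M0|clear - s2; lra].
(* If one factor reaches [M], so does the larger one, and the product is at most its square. *)
have tail2 x y : `|x * y - t x * t y| <= M `^ (2 - s) * (`|x| `^ s + `|y| `^ s).
  have H u v : `|v| <= `|u| -> M <= `|u| -> `|u * v| <= M `^ (2 - s) * (`|u| `^ s + `|v| `^ s).
    move=> vu Mu; rewrite mulrDr.
    apply: (@le_trans _ _ (M `^ (2 - s) * `|u| `^ s)); last by rewrite lerDl mulr_ge0 ?powR_ge0.
    apply: le_trans (powR_tail _ (ltW s2)); last by rewrite M0.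
    by rewrite powR_mulrn// normrM expr2 ler_wpM2l.
  have H' : M <= `|x| \/ M <= `|y| -> `|x * y| <= M `^ (2 - s) * (`|x| `^ s + `|y| `^ s).
    case: (leP `|y| `|x|) => xy Mxy; first by apply: H => //; case: Mxy => // /le_trans; apply.
    rewrite mulrC [`|x| `^ s + _]addrC; apply: H; first exact: ltW.
    by case: Mxy => // /le_trans; apply; exact: ltW.
  rewrite /t; case: ifPn => [_|]; last by rewrite -ltNge => /ltW ?; rewrite mul0r subr0; apply: H'; left.
  case: ifPn => [_|]; last by rewrite -ltNge => /ltW ?; rewrite mulr0 subr0; apply: H'; right.
  by rewrite subrr normr0 mulr_ge0 ?addr_ge0 ?powR_ge0.
have b0 : 0 <= b by apply: le_trans (Xb point).
have LX : L1 X by exact: L1_bounded Xb.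
have LY : L1 Y by exact: L1_bounded Yb.
have LZs (Z : Omega -> R) : measurable_fun setT Z -> (forall w, `|Z w| <= b) -> L1 (fun w => `|Z w| `^ s).
  move=> mZ Zb; apply: (@L1_bounded _ _ _ _ _ (b `^ s)) => [|w].
    by apply: (@measurableT_comp _ _ _ _ _ _ (fun x : R => x `^ s)) => //; exact: measurableT_comp.
  by rewrite ger0_norm ?powR_ge0// ge0_ler_powR// ?nnegrE//; clear - s2; lra.
have LXs := LZs _ mX Xb; have LYs := LZs _ mY Yb.
have mtX : measurable_fun setT (fun w => t (X w)) by exact: measurableT_comp.
have mtY : measurable_fun setT (fun w => t (Y w)) by exact: measurableT_comp.
have LtX : L1 (fun w => t (X w)) by apply: (@L1_bounded _ _ _ _ _ M).
have LtY : L1 (fun w => t (Y w)) by apply: (@L1_bounded _ _ _ _ _ M).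
have LXY : L1 (fun w => X w * Y w).
  apply: (@L1_bounded _ _ _ _ _ (b * b)) => [|w]; first exact: measurable_funM.
  by rewrite normrM ler_pM.
have LtXY : L1 (fun w => t (X w) * t (Y w)).
  apply: (@L1_bounded _ _ _ _ _ (M * M)) => [|w]; first exact: measurable_funM.
  by rewrite normrM ler_pM.
have B0 : 0 <= B by apply: le_trans EX; apply: E_ge0 => w; exact: powR_ge0.
set m := M `^ (2 - s); have m0 : 0 <= m := powR_ge0 _ _.
have H1 : `|E (fun w => X w * Y w) - E (fun w => t (X w) * t (Y w))| <= m * (B + B).
  rewrite -EB//; apply: le_trans (E_abs_le (L1B LXY LtXY) (L1Z m (L1D LXs LYs)) _) _.
    by move=> w; exact: tail2.
  by rewrite EZ ?ED//; [rewrite ler_wpM2l// lerD|exact: L1D].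
have EM (Z : Omega -> R) : measurable_fun setT Z -> (forall w, `|Z w| <= b) ->
    E (fun w => `|Z w| `^ s) <= B -> L1 (fun w => t (Z w)) ->
    `|E Z| <= 1 + B /\ `|E (fun w => t (Z w))| <= 1 + B /\ `|E Z - E (fun w => t (Z w))| <= m * B.
  move=> mZ Zb EZ' LtZ; have LZ : L1 Z by exact: L1_bounded Zb.
  have LZ1 : L1 (fun w => 1 + `|Z w| `^ s) by apply: L1D; [exact: L1_cst|exact: LZs].
  have EZ1 : E (fun w => 1 + `|Z w| `^ s) <= 1 + B.
    by rewrite ED ?E_cst ?lerD2l//; [exact: L1_cst|exact: LZs].
  have s1 : 1 <= s by clear - s2; lra.
  split; [|split].
  - by apply: le_trans EZ1; apply: E_abs_le => // w; exact: abs_le_1powR.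
  - apply: le_trans EZ1; apply: E_abs_le => // w.
    by apply: le_trans (tx _) _; exact: abs_le_1powR.
  - rewrite -EB//; apply: (@le_trans _ _ (M `^ (1 - s) * B)).
      apply: (@le_trans _ _ (M `^ (1 - s) * E (fun w => `|Z w| `^ s))); last by rewrite ler_wpM2l ?powR_ge0.
      rewrite -EZ; last exact: LZs.
      by apply: E_abs_le => //; [exact: L1B|apply/L1Z/LZs].
    by rewrite ler_wpM2r// ler_powR// lerD2r ler1n.
have [X1 [X2 X3]] := EM _ mX Xb EX LtX.
have [Y1 [Y2 Y3]] := EM _ mY Yb EY LtY.
have H2 : `|E (fun w => t (X w)) * E (fun w => t (Y w)) - E X * E Y| <= 2 * (m * B * (1 + B)).
  set x' := E (fun w => t (X w)); set y' := E (fun w => t (Y w)).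
  rewrite (_ : _ - _ = - (x' * (E Y - y') + E Y * (E X - x'))); last by ring.
  rewrite normrN; apply: le_trans (ler_normD _ _) _; rewrite !normrM.
  rewrite (_ : 2 * _ = (1 + B) * (m * B) + (1 + B) * (m * B)); last by ring.
  by rewrite lerD// ler_pM.
have H3 := cov_bounded mX mY mt mt M0 tM M0 tM XY.
apply: le_trans (ler_distD (E (fun w => t (X w) * t (Y w))) _ _) _.
apply: le_trans (lerD H1 (ler_distD (E (fun w => t (X w)) * E (fun w => t (Y w))) _ _)) _.
apply: le_trans (lerD (lexx _) (lerD H3 H2)) _.
rewrite addrCA expr2 -[4 * M * M]mulrA lerD2l.
have : m * (B + B) + 2 * (m * B * (1 + B)) = m * (4 * B + 2 * B ^+ 2) by ring.
move=> ->; rewrite -(mulrA 4) [leRHS]mulrCA ler_wpM2l//; clear - B0; nra.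
Qed.

End covariance.

(** * Mixing sequences *)

Section sigma.
Context {R : realType} {d : measure_display} {Omega : measurableType d}.
Variable P : probability Omega R.
Local Notation E f := (\int[P]_w f w)%R.
Local Notation L1 := (L1 P).
Local Notation Pr := (Pr P).
Implicit Types Z X : nat -> Omega -> R.

Definition gen_of Z (I : set nat) : set (set Omega) :=
  [set A | exists i, I i /\ exists U : set R, measurable U /\ A = Z i @^-1` U].

Definition sigma_of Z (I : set nat) : set (set Omega) := <<s gen_of Z I >>.

Definition adapted Z (I : set nat) (F : Omega -> R) :=
  forall U : set R, measurable U -> sigma_of Z I (F @^-1` U).

(** Measurability for a sub-sigma-field is ordinary measurability on another [measurableType], so
    closure under sums and products is inherited. *)
Lemma adaptedP Z I F : adapted Z I F <->
  measurable_fun (setT : set (g_sigma_algebraType (gen_of Z I))) F.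
Proof.
split=> [aF _ U mU|mF U mU]; first by rewrite setTI; exact: aF.
by have := mF measurableT U mU; rewrite setTI.
Qed.

Lemma adapted_id Z (I : set nat) i : I i -> adapted Z I (Z i).
Proof.
by move=> Ii U mU; apply: sub_gen_smallest; exists i; split => //; exists U.
Qed.

Lemma adapted_cst Z I (r : R) : adapted Z I (fun=> r).
Proof. exact/adaptedP. Qed.

Lemma adaptedB Z I F G : adapted Z I F -> adapted Z I G -> adapted Z I (fun w => F w - G w).
Proof.
move=> /adaptedP aF /adaptedP aG; apply/adaptedP.
exact: measurable_funB aF aG.
Qed.

Lemma adaptedZ Z I (k : R) F : adapted Z I F -> adapted Z I (fun w => k * F w).
Proof.
move=> /adaptedP aF; apply/adaptedP.
by apply: measurable_funM aF.
Qed.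

Lemma adapted_sum Z I (J : Type) (r : seq J) (Q : pred J) (F : J -> Omega -> R) :
  (forall j, Q j -> adapted Z I (F j)) -> adapted Z I (fun w => \sum_(j <- r | Q j) F j w).
Proof.
move=> aF; apply/adaptedP.
rewrite (_ : (fun w => _) = (fun w => \sum_(j <- r) (if Q j then F j w else 0))); last first.
  by apply/funext => w; rewrite big_mkcond.
apply: (@measurable_sum _ (g_sigma_algebraType (gen_of Z I))) => j.
by case: (boolP (Q j)) => // /aF /adaptedP.
Qed.

Lemma sigma_of_sub Z X (I J : set nat) :
  (forall i, I i -> adapted Z J (X i)) -> sigma_of X I `<=` sigma_of Z J.
Proof.
move=> H; apply: smallest_sub; first exact: smallest_sigma_algebra.
by move=> A [i [Ii [U [mU ->]]]]; exact: H.
Qed.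

Lemma sigma_of_mono Z (I J : set nat) : I `<=` J -> sigma_of Z I `<=` sigma_of Z J.
Proof. by move=> IJ; apply: sigma_of_sub => i /IJ; exact: adapted_id. Qed.

(** Past and future are taken among all natural numbers, so that no sample size appears;
    [mixing_at_window] links this to [mixing_coef]. *)
Definition mixing_at Z (k : nat) (a : R) := forall l A B,
  sigma_of Z [set i | (i <= l)%N] A -> sigma_of Z [set i | (l + k <= i)%N] B ->
  `|Pr (A `&` B) - Pr A * Pr B| <= a.

Lemma mixing_at_dep Z k a l (I J : set nat) F G : mixing_at Z k a ->
  I `<=` [set i | (i <= l)%N] -> J `<=` [set i | (l + k <= i)%N] ->
  adapted Z I F -> adapted Z J G -> dep P F G a.
Proof.
move=> mZ Il Jl aF aG U V mU mV.
by apply: (mZ l); [apply: (sigma_of_mono Il); exact: aF|apply: (sigma_of_mono Jl); exact: aG].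
Qed.

(** Covers the empty sum that precedes the first block. *)
Lemma dep_cst (r : R) (Y : Omega -> R) a : measurable_fun setT Y -> 0 <= a -> dep P (fun=> r) Y a.
Proof.
move=> mY a0 U V mU mV; rewrite preimage_cst; case: ifP => _.
  by rewrite setTI (_ : Pr setT = 1) ?mul1r ?subrr ?normr0// /Pr; rewrite probability_setT.
by rewrite set0I (_ : Pr set0 = 0) ?mul0r ?subrr ?normr0// /Pr; rewrite measure0.
Qed.

Lemma big_ord_mul (M n : nat) (f : nat -> R) :
  \sum_(i < M * n) f i = \sum_(m < M) \sum_(i < n) f (m * n + i)%N.
Proof.
elim: M => [|M IH]; first by rewrite mul0n !big_ord0.
by rewrite big_ord_recr/= -IH mulSnr big_split_ord.
Qed.

Lemma big_ord_double (q : nat) (f : nat -> R) :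
  \sum_(i < q.*2) f i = \sum_(k < q) f k.*2 + \sum_(k < q) f k.*2.+1.
Proof.
elim: q => [|q IH]; first by rewrite !big_ord0 addr0.
by rewrite doubleS !big_ord_recr/= IH; ring.
Qed.

(** The term (n+1)^(-3/2) lies below the telescoping difference 2/sqrt n - 2/sqrt(n+1). With a and b
    the two roots, inserting 1 = (b - a)(b + a) lets b - a cancel. *)
Lemma inv_threehalves_step (n : nat) : (0 < n)%N ->
  (n.+1%:R * Num.sqrt n.+1%:R)^-1 + 2 / Num.sqrt n.+1%:R <= 2 / Num.sqrt n%:R :> R.
Proof.
move=> n0; set a := Num.sqrt n%:R; set b := Num.sqrt n.+1%:R.
have a0 : 0 < a by rewrite sqrtr_gt0 ltr0n.
have b0 : 0 < b by rewrite sqrtr_gt0 ltr0n.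
have a2 : a ^+ 2 = n%:R by rewrite sqr_sqrtr.
have b2 : b ^+ 2 = n.+1%:R by rewrite sqr_sqrtr.
have ab : b ^+ 2 = a ^+ 2 + 1 by rewrite a2 b2 natr1.
rewrite -b2 -lerBrDr.
have -> : 2 / a - 2 / b = 2 * (b - a) / (a * b) by field; rewrite !gt_eqF.
have lab : a <= b by rewrite ler_sqrt ?ler_nat.
rewrite ler_pdivlMr ?mulr_gt0// mulrC -[leLHS]/(_ / _) ler_pdivrMr ?mulr_gt0 ?exprn_gt0//.
have : 1 = (b - a) * (b + a) by nra.
move=> e1; rewrite -[leLHS]mulr1 [X in _ * X <= _]e1.
have -> : 2 * (b - a) * (b ^+ 2 * b) = b * (b - a) * (2 * b ^+ 2) by ring.
have -> : a * b * ((b - a) * (b + a)) = b * (b - a) * (a * (b + a)) by ring.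
by rewrite ler_wpM2l ?mulr_ge0 ?subr_ge0// ?ltW//; nra.
Qed.

Lemma sum_inv_threehalves (n : nat) :
  \sum_(i < n) ((n - i)%:R * Num.sqrt (n - i)%:R)^-1 <= 3 :> R.
Proof.
(* The bound with the subtracted remainder is the one that telescopes; its first instance is 1 = 3 -
   2. *)
suff H k : \sum_(i < k.+1) ((k.+1 - i)%:R * Num.sqrt (k.+1 - i)%:R)^-1 <=
    3 - 2 / Num.sqrt k.+1%:R :> R.
  case: n => [|n]; first by rewrite big_ord0.
  by apply: le_trans (H n) _; rewrite gerBl divr_ge0 ?sqrtr_ge0.
elim: k => [|k IH]; first by rewrite big_ord1 /= subn0 sqrtr1 mulr1 invr1; lra.
rewrite big_ord_recl subn0 (eq_bigr (fun i : 'I_k.+1 => ((k.+1 - i)%:R * Num.sqrt (k.+1 - i)%:R)^-1)); last first.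
  by move=> i _; rewrite lift0 subSS.
have := @inv_threehalves_step k.+1 isT; rewrite -lerBrDr => H.
apply: le_trans (lerD H IH) _; rewrite le_eqVlt; apply/orP; left; apply/eqP.
by rewrite addrCA; congr (_ + _); rewrite addrAC subrr add0r.
Qed.

(** * Concentration of a bounded mixing sequence *)

Section conc.
Variables (Z : nat -> Omega -> R) (A B b s beta : R).
Hypotheses (mZ : forall i, measurable_fun setT (Z i)) (b0 : 0 < b)
  (Zb : forall i w, `|Z i w| <= b)
  (EZs : forall i, E (fun w => `|Z i w| `^ s) <= B)
  (A0 : 0 < A) (s2 : 2 < s) (rho : 3 / 2 * s <= beta * (s - 2))
  (mix : forall k, (0 < k)%N -> mixing_at Z k (A * k%:R `^ (- beta))).

Let s0 : 0 < s. Proof. exact: lt_trans s2. Qed.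

Let X i w := Z i w - E (Z i).
(** The value of [cov_moment] with the powers of the lag removed; it also dominates the second
    moment bound 1 + B. *)
Let D := 4 * A + 4 * (1 + B) ^+ 2.

Let B0 : 0 <= B.
Proof. by apply: le_trans (EZs 0); apply: E_ge0 => w; exact: powR_ge0. Qed.

Let LZ i : L1 (Z i). Proof. exact: L1_bounded (Zb i). Qed.

Let EZb i : `|E (Z i)| <= b. Proof. exact: E_abs_le_cst. Qed.

Let mX i : measurable_fun setT (X i).
Proof. by apply: measurable_funB. Qed.

Let Xb i w : `|X i w| <= 2 * b.
Proof. by rewrite mulr_natl mulr2n; apply: le_trans (ler_normB _ _) _; rewrite lerD. Qed.

Let LX i : L1 (X i). Proof. exact: L1_bounded (Xb i). Qed.

Let EX i : E (X i) = 0.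
Proof. by rewrite /X EB ?E_cst ?subrr//; exact: L1_cst. Qed.

Let LZZ i k : L1 (fun w => Z i w * Z k w).
Proof.
apply: (@L1_bounded _ _ _ _ _ (b * b)) => [|w]; first exact: measurable_funM.
by rewrite normrM ler_pM.
Qed.

Let EXX i k : E (fun w => X i w * X k w) = E (fun w => Z i w * Z k w) - E (Z i) * E (Z k).
Proof.
have -> : E (fun w => X i w * X k w) =
    E (fun w => Z i w * Z k w - E (Z k) * Z i w + (E (Z i) * E (Z k) - E (Z i) * Z k w)).
  by apply: eqE => w; rewrite /X; ring.
rewrite ED; [|by apply/L1B/L1Z|by apply: L1B; [exact: L1_cst|exact: L1Z]].
rewrite EB//; last exact: L1Z.
rewrite EB; [|exact: L1_cst|exact: L1Z].
by rewrite E_cst !EZ//; ring.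
Qed.

Let Ls i : L1 (fun w => `|Z i w| `^ s).
Proof.
apply: (@L1_bounded _ _ _ _ _ (b `^ s)) => [|w].
  by apply: (@measurableT_comp _ _ _ _ _ _ (fun x : R => x `^ s)) => //; exact: measurableT_comp.
rewrite ger0_norm ?powR_ge0//; apply: ge0_ler_powR; rewrite ?nnegrE//; first exact: ltW.
exact: ltW.
Qed.

Lemma cov_diag i : E (fun w => X i w ^+ 2) <= D.
Proof.
have -> : E (fun w => X i w ^+ 2) = E (fun w => Z i w * Z i w) - E (Z i) * E (Z i).
  by rewrite -EXX; apply: eqE => w; rewrite expr2.
have H : E (fun w => Z i w * Z i w) <= 1 + B.
  apply: (@le_trans _ _ (E (fun w => 1 + `|Z i w| `^ s))).
    apply: E_le => //; first by apply: L1D => //; exact: L1_cst.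
    move=> w; rewrite -expr2 -[leLHS]ger0_norm ?sqr_ge0// normrX.
    case: (leP `|Z i w| 1) => z1; first by rewrite ler_wpDr ?powR_ge0// exprn_ile1.
    by rewrite ler_wpDl// -powR_mulrn// ler_powR ?ltW.
  by rewrite ED ?E_cst ?lerD2l//; exact: L1_cst.
rewrite lerBlDr; apply: le_trans H _; rewrite /D.
by have := sqr_ge0 (E (Z i)); move: A0 B0; rewrite expr2; nra.
Qed.

Let D0 : 0 <= D.
Proof. by apply: addr_ge0; apply: mulr_ge0 => //; [exact: ltW|exact: sqr_ge0]. Qed.

(** Hypothesis [rho] makes the decay exponent beta (s - 2) / s at least 3/2, so these bounds are
    summable over the lag, independently of [b]. *)
Lemma cov_offdiag i k : (i < k)%N ->
  `|E (fun w => X i w * X k w)| <= D * ((k - i)%:R * Num.sqrt (k - i)%:R)^-1.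
Proof.
move=> ik; rewrite EXX; set r : R := (k - i)%:R.
have r1 : 1 <= r by rewrite ler1n subn_gt0.
have r0 : 0 < r by lra.
have beta0 : 0 <= beta / s.
  rewrite divr_ge0 ?ltW//; have : 0 < beta * (s - 2) by apply: lt_le_trans rho; rewrite mulr_gt0.
  by rewrite pmulr_lgt0// subr_gt0.
have dp : dep P (Z i) (Z k) (A * r `^ (- beta)).
  apply: (@mixing_at_dep Z (k - i) _ i [set i] [set k]).
  - by apply: mix; rewrite subn_gt0.
  - by move=> _ ->/=.
  - by move=> _ ->/=; rewrite subnKC// ltnW.
  - exact: adapted_id.
  - exact: adapted_id.
(* Truncating at [r^(beta/s)] balances the two terms of [cov_moment]. *)
have M1 : 1 <= r `^ (beta / s) by rewrite -[leLHS](powRr0 r) ler_powR.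
apply: le_trans (cov_moment (mZ i) (mZ k) dp s2 M1 (Zb i) (Zb k) (EZs i) (EZs k)) _.
have e1 : (r `^ (beta / s)) ^+ 2 * r `^ (- beta) = r `^ (- (beta * (s - 2) / s)).
  rewrite -powR_mulrn ?powR_ge0// -powRrM -powR_addp//.
  by congr (_ `^ _); field; rewrite gt_eqF.
have e2 : (r `^ (beta / s)) `^ (2 - s) = r `^ (- (beta * (s - 2) / s)).
  by rewrite -powRrM; congr (_ `^ _); field; rewrite gt_eqF.
have e3 : r `^ (- (beta * (s - 2) / s)) <= (r * Num.sqrt r)^-1.
  rewrite -(powR12_sqrt (ltW r0)) -{2}(powRr1 (ltW r0)) -powR_addp//.
  rewrite -powRN. apply: ler_powR => //; rewrite lerN2 ler_pdivlMr//.
  by apply: le_trans rho; rewrite ler_wpM2r ?(ltW s0)//; lra.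
have -> : 4 * (r `^ (beta / s)) ^+ 2 * (A * r `^ (- beta)) = 4 * A * r `^ (- (beta * (s - 2) / s)).
  by rewrite -e1; ring.
rewrite e2 [4 * r `^ _ * _]mulrAC -mulrDl.
exact: ler_wpM2l D0 _ _ e3.
Qed.

(** Appending one index adds a diagonal term, at most D, and twice a sum of cross covariances, at
    most 3 D: hence 7 = 1 + 6. *)
Lemma block_variance j n : E (fun w => (\sum_(i < n) X (j + i) w) ^+ 2) <= 7 * D * n%:R.
Proof.
elim: n => [|n IH].
  rewrite mulr0 -[leRHS](E_cst P) le_eqVlt; apply/orP; left; apply/eqP.
  by apply: eqE => w; rewrite big_ord0 expr0n.
have LXX i k : L1 (fun w => X i w * X k w).
  apply: (@L1_bounded _ _ _ _ _ (2 * b * (2 * b))) => [|w]; first exact: measurable_funM.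
  by rewrite normrM ler_pM.
have LS m : L1 (fun w => (\sum_(i < m) X (j + i) w) ^+ 2).
  rewrite (_ : (fun w => _) = (fun w => \sum_(i < m) \sum_(k < m) X (j + i) w * X (j + k) w)).
    by apply: L1_sum => i; exact: L1_sum.
  by apply/funext => w; rewrite expr2 big_distrlr.
have -> : E (fun w => (\sum_(i < n.+1) X (j + i) w) ^+ 2) =
  E (fun w => (\sum_(i < n) X (j + i) w) ^+ 2 +
     (2 * (\sum_(i < n) X (j + i) w * X (j + n) w) + X (j + n) w ^+ 2)).
  by apply: eqE => w; rewrite big_ord_recr/= -mulr_suml; ring.
have LX2 : L1 (fun w => X (j + n) w ^+ 2).
  by rewrite (_ : (fun w => _) = (fun w => X (j + n) w * X (j + n) w)).
rewrite ED//; last by apply: L1D => //; apply: L1Z; apply: L1_sum.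
rewrite ED//; last by apply: L1Z; apply: L1_sum.
rewrite EZ; last exact: L1_sum.
rewrite E_sum//.
have : \sum_(i < n) E (fun w => X (j + i) w * X (j + n) w) <= D * 3.
  apply: (@le_trans _ _ (D * \sum_(i < n) ((n - i)%:R * Num.sqrt (n - i)%:R)^-1)).
    rewrite mulr_sumr; apply: ler_sum => i _; apply: le_trans (ler_norm _) _.
    by rewrite -(subnDl j); apply: cov_offdiag; rewrite ltn_add2l.
  by rewrite ler_wpM2l// sum_inv_threehalves.
by have := cov_diag (j + n); rewrite -natr1; lra.
Qed.

Let blk n m w := \sum_(i < n) X (m * n + i) w.

Let bound n q lam t := expR (- lam * t + 2 * lam ^+ 2 * (7 * D * n%:R) * q%:R) +
  2 * q%:R * (A * n%:R `^ (- beta)).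

Let mblk n m : measurable_fun setT (blk n m).
Proof. by apply: measurable_sum => i. Qed.

(** [e] chooses the even or the odd blocks and [c] the sign. Successive blocks of one parity are
    separated by a block of the other, hence by a lag of [n]. *)
Lemma block_bernstein_signed n q lam t (c : R) (e : bool) : (0 < n)%N -> `|c| = 1 -> 0 < lam ->
  lam * (n%:R * (2 * b)) <= 2^-1 ->
  Pr [set w | t <= \sum_(k < q) c * blk n (k.*2 + e) w] <= bound n q lam t.
Proof.
move=> n0 c1 lam0 lamb.
have A'0 : 0 <= A * n%:R `^ (- beta) by rewrite mulr_ge0 ?powR_ge0 ?ltW.
have c2 : c ^+ 2 = 1 by rewrite -[LHS]ger0_norm ?sqr_ge0// normrX c1 expr1n.
apply: (@bernstein_dep _ _ _ P (fun k w => c * blk n (k.*2 + e) w) (n%:R * (2 * b))) => //.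
- by move=> k; exact: measurable_funM.
- move=> k w; rewrite normrM c1 mul1r; apply: le_trans (ler_norm_sum _ _ _) _.
  by rewrite -[n in n%:R]card_ord -sum1_card natr_sum mulr_suml; apply: ler_sum => i _; rewrite mul1r.
- move=> k; rewrite EZ; last exact: L1_sum.
  by rewrite E_sum// big1 ?mulr0.
- move=> k; apply: le_trans (block_variance ((k.*2 + e) * n) n).
  rewrite le_eqVlt; apply/orP; left; apply/eqP.
  by apply: eqE => w; rewrite exprMn c2 mul1r.
- by rewrite !mulr_ge0// ltW.
move=> k kq; case: k kq => [_|k kq].
  rewrite (_ : (fun w => _) = (fun=> 0)); last by apply/funext => w; rewrite big_ord0.
  by apply: dep_cst => //; exact: measurable_funM.
apply: (@mixing_at_dep Z n _ ((k.*2.+1 + e) * n) [set i | (i <= (k.*2.+1 + e) * n)%N]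
   [set i | ((k.*2.+1 + e) * n + n <= i)%N]) => //.
- exact: mix.
- apply: adapted_sum => i _; apply: adaptedZ; apply: adapted_sum => i' _.
  apply: adaptedB; last exact: adapted_cst.
  apply: adapted_id => /=; apply: (@leq_trans ((i.*2 + e) * n + n)); first by rewrite leq_add2l ltnW.
  by rewrite -mulSnr leq_mul2r -addSn leq_add2r !ltnS leq_double -ltnS ltn_ord orbT.
- apply: adaptedZ; apply: adapted_sum => i _.
  apply: adaptedB; last exact: adapted_cst.
  by apply: adapted_id => /=; rewrite -mulSnr -addSn -doubleS leq_addr.
Qed.

(** When the even and odd sums add up to at least 2 t in absolute value, one of them, with one of
    the signs, reaches [t]; hence four events. *)
Lemma block_bernstein n q lam t : (0 < n)%N -> 0 < lam ->
  lam * (n%:R * (2 * b)) <= 2^-1 ->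
  Pr [set w | 2 * t <= `|\sum_(i < q.*2 * n) X i w|] <= 4 * bound n q lam t.
Proof.
move=> n0 lam0 lamb.
pose S (c : R) (e : bool) := [set w | t <= \sum_(k < q) c * blk n (k.*2 + e) w].
have mS c e : measurable (S c e).
  rewrite -[X in measurable X]setTI; apply: measurable_fun_le => //.
  by apply: measurable_sum => k; exact: measurable_funM.
have c1 : `|1| = 1 :> R by rewrite normr1.
have cN1 : `|-1| = 1 :> R by rewrite normrN1.
have H (c : R) e : `|c| = 1 -> Pr (S c e) <= bound n q lam t by move=> ?; exact: block_bernstein_signed.
apply: (@le_trans _ _ (Pr ((S 1 false `|` S 1 true) `|` (S (-1) false `|` S (-1) true)))).
  apply: Pr_le; last first.
  - move=> w /=; rewrite (big_ord_mul _ _ (fun i => X i w)) (big_ord_double _ (fun m => blk n m w)).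
    set u := \sum_(k < q) _; set v := \sum_(k < q) _ => tuv.
    have Su c : S c false w = (t <= c * u).
      by rewrite /S /= -mulr_sumr; congr (is_true (_ <= _ * _)); apply: eq_bigr => k _; rewrite addn0.
    have Sv c : S c true w = (t <= c * v).
      by rewrite /S /= -mulr_sumr; congr (is_true (_ <= _ * _)); apply: eq_bigr => k _; rewrite addn1.
    rewrite !Su !Sv !mul1r !mulN1r.
    have [tu|tu] := leP t u; first by left; left.
    have [tv|tv] := leP t v; first by left; right.
    have [tu'|tu'] := leP t (- u); first by right; left.
    have [tv'|tv'] := leP t (- v); first by right; right.
    exfalso; move: tuv; rewrite leNgt => /negP; apply.
    by rewrite ltr_norml; apply/andP; split; lra.
  - by apply: measurableU; apply: measurableU.
  - rewrite -[X in measurable X]setTI; apply: measurable_fun_le => //.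
    by apply: measurableT_comp => //; apply: measurable_sum.
apply: le_trans (PrU _ _ _) _; try by apply: measurableU.
rewrite (_ : 4 * bound n q lam t = (bound n q lam t + bound n q lam t) + (bound n q lam t + bound n q lam t)); last by ring.
by apply: lerD; (apply: le_trans (PrU _ _ _) _ => //; apply: lerD; exact: H).
Qed.
End conc.

End sigma.

(** * From the triangular array to sequences *)

Section transfer.
Context {R : realType} {d : measure_display} {Omega : measurableType d}.
Variable P : probability Omega R.
Local Notation Pr := (Pr P).

Lemma sigma_of_cst (Z : nat -> Omega -> R) (I : set nat) A :
  (forall i, I i -> exists r, Z i = fun=> r) -> sigma_of Z I A -> A = set0 \/ A = setT.
Proof.
move=> H; apply: (@smallest_sub _ _ _ [set B | B = set0 \/ B = setT]).
  split=> /=; first by left.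
  - by move=> B [->|->]; rewrite ?setD0 ?setDv; [right|left].
  - move=> F HF; have [[i Fi]|nF] := pselect (exists i, F i = setT).
      by right; apply/seteqP; split => // w _; exists i => //; rewrite Fi.
    left; apply/seteqP; split => // w [i _]; case: (HF i) => [->//|Fi].
    by case: nF; exists i.
move=> B [i [Ii [U [mU ->]]]] /=; have [r ->] := H i Ii.
by rewrite preimage_cst; case: ifP => _; [right|left].
Qed.

(* Outside 1..T the sequence is constant, hence contributes a trivial sigma-field;
   this keeps windows overlapping the boundary within the mixing framework. *)
Lemma mixing_at_window m (eps : nat -> nat -> 'rV[R]_m -> Omega -> R) T g
    (phi : nat -> R -> R) i0 k a :
  (forall i, measurable_fun setT (eps T i g)) -> (forall i, measurable_fun setT (phi i)) ->
  (0 < k)%N -> mixing_coef P eps T g k <= a -> 0 <= a ->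
  mixing_at P (fun i w => if (1 <= i0 + i <= T)%N then phi i (eps T (i0 + i) g w) else 0) k a.
Proof.
move=> meps mphi k0 mixa a0 l A B; set Z := fun i w => _.
move=> ZA ZB.
have trivA : A = set0 \/ A = setT -> `|Pr (A `&` B) - Pr A * Pr B| <= a.
  move=> [->|->]; rewrite ?set0I ?setTI /Pr ?measure0 ?probability_setT/=.
    by rewrite mul0r subrr normr0.
  by rewrite mul1r subrr normr0.
have trivB : B = set0 \/ B = setT -> `|Pr (A `&` B) - Pr A * Pr B| <= a.
  move=> [->|->]; rewrite ?setI0 ?setIT /Pr ?measure0 ?probability_setT/=.
    by rewrite mulr0 subrr normr0.
  by rewrite mulr1 subrr normr0.
(* If this sum is 0, the past contains only index 0, where the sequence is constant. *)
have [L0|L0] := posnP (i0 + l).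
  apply: trivA; apply: (@sigma_of_cst Z _ _ _ ZA) => i /= il; exists 0; apply/funext => w; rewrite /Z.
  by move/eqP: L0; rewrite addn_eq0 => /andP[/eqP i00 /eqP l0]; move: il; rewrite l0 leqn0 => /eqP ->; rewrite i00.
(* If this sum exceeds [T], the future is constant. *)
have [LT|LT] := leqP (i0 + l + k) T; last first.
  apply: trivB; apply: (@sigma_of_cst Z _ _ _ ZB) => i /= il; exists 0; apply/funext => w; rewrite /Z.
  case: ifP => // /andP[_ iT]; move: LT; rewrite ltnNge => /negP; case.
  by apply: leq_trans iT; rewrite -addnA leq_add2l.
have aZ (I J : set nat) : (forall i, I i -> (1 <= i0 + i <= T)%N -> J (i0 + i)%N) ->
    sigma_of Z I `<=` sigma_of (fun r => eps T r g) J.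
  move=> IJ; apply: sigma_of_sub => i Ii; rewrite /Z; case: (boolP (1 <= i0 + i <= T)%N) => iT.
    apply/adaptedP; apply: measurableT_comp => //; apply/adaptedP; apply: adapted_id; exact: IJ.
  exact: adapted_cst.
have sA : sigmaF eps T g 1 (i0 + l) A.
  by apply: (aZ [set i | (i <= l)%N]) ZA => i /= il /andP[-> _]/=; rewrite leq_add2l.
have sB : sigmaF eps T g (i0 + l + k) T B.
  by apply: (aZ [set i | (l + k <= i)%N]) ZB => i /= il /andP[_ ->]; rewrite andbT -addnA leq_add2l.
have msF i i' C : sigmaF eps T g i i' C -> measurable C.
  apply: smallest_sub C; first exact: sigma_algebra_measurable.
  by move=> C [r [_ [U [mU ->]]]]; rewrite -[X in measurable X]setTI; exact: meps.
apply: le_trans mixa; rewrite /mixing_coef gtn_eqF// leqNgt (_ : (k < T)%N = true); last first.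
  by apply: leq_trans LT; rewrite -[k.+1]add1n leq_add2r.
(* [sup] is informative only on a bounded set, and 1 is an upper bound here. The two events swap
   roles, since in [mixing_coef] the past event is [B]. *)
apply: ub_le_sup; last first.
  exists (i0 + l)%N; split; first by rewrite L0/= leq_subRL ?(leq_trans (leq_addl _ _) LT)// addnC.
  by exists A; exists B; split=> //; split=> //; rewrite setIC [Pr A * _]mulrC.
exists 1 => _ [l' [_ [B' [A' [sB' [sA' ->]]]]]].
have mA' := msF _ _ _ sA'; have mB' := msF _ _ _ sB'.
rewrite -!/(Pr _); have := Pr_ge0 P (A' `&` B'); have := Pr_le1 P (measurableI _ _ mA' mB').
have := Pr_ge0 P A'; have := Pr_le1 P mA'; have := Pr_ge0 P B'; have := Pr_le1 P mB'.
by move=> *; rewrite ler_norml; apply/andP; split; nra.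
Qed.

End transfer.

(** * Kernel weights and grids *)

Section kernel.
Context {R : realType}.

Lemma lipschitz_pow (L : R) j : 1 <= L -> exists2 C : R, 0 <= C &
  forall u v, `|u| <= L -> `|v| <= L -> `|u ^+ j - v ^+ j| <= C * `|u - v|.
Proof.
move=> L1; elim: j => [|j [C C0 IH]].
  by exists 0 => // u v _ _; rewrite !expr0 subrr normr0 mul0r.
have L0 : 0 <= L by lra.
exists (L * C + L ^+ j) => [|u v uL vL]; first by rewrite addr_ge0 ?mulr_ge0 ?exprn_ge0.
rewrite (_ : _ - _ = u * (u ^+ j - v ^+ j) + v ^+ j * (u - v)); last by rewrite !exprS; ring.
apply: le_trans (ler_normD _ _) _; rewrite !normrM mulrDl -mulrA lerD//.
  by rewrite ler_pM// IH.
by rewrite ler_wpM2r// normrX lerXn2r// nnegrE.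
Qed.

(** On the support of [K] the power is bounded and Lipschitz. A single [k] serves as both bound and
    Lipschitz constant. *)
Lemma kernel_moment (K : R -> R) (Kbar Lam L : R) j :
  1 <= L -> (forall u, `|K u| <= Kbar) -> (forall u, L < `|u| -> K u = 0) ->
  (forall u v, `|K u - K v| <= Lam * `|u - v|) ->
  exists2 k : R, 1 <= k & [/\ (forall u, `|K u * u ^+ j| <= k),
    (forall u, L < `|u| -> K u * u ^+ j = 0) &
    forall u v, `|K u * u ^+ j - K v * v ^+ j| <= k * `|u - v|].
Proof.
move=> L1 Kb KL KLip; have [C C0 HC] := @lipschitz_pow L j L1.
have L0 : 0 <= L by lra.
have K0 : 0 <= Kbar by apply: le_trans (Kb 0).
have Lam0 : 0 <= Lam by have := KLip 0 1; rewrite sub0r normrN1 mulr1; apply: le_trans.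
have p1 : 0 <= Kbar * L ^+ j by rewrite mulr_ge0 ?exprn_ge0.
have p2 : 0 <= Lam * L ^+ j by rewrite mulr_ge0 ?exprn_ge0.
have p3 : 0 <= Kbar * C by rewrite mulr_ge0.
have pow u : `|u| <= L -> `|u ^+ j| <= L ^+ j.
  by move=> uL; rewrite normrX lerXn2r// nnegrE.
have out u : L < `|u| -> K u * u ^+ j = 0 by move=> /KL ->; rewrite mul0r.
(* With [v] outside the support, [K u] equals [K u - K v], so the Lipschitz bound of [K] alone
   suffices. *)
have Lip1 u v : `|u| <= L -> L < `|v| -> `|K u * u ^+ j| <= Lam * L ^+ j * `|u - v|.
  move=> uL vL; rewrite normrM mulrAC -[K u]subr0 -(KL v vL).
  by rewrite ler_pM// pow.
exists (1 + Kbar * L ^+ j + Lam * L ^+ j + Kbar * C); first lra.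
split=> [u||u v].
- have [uL|uL] := leP `|u| L; last by rewrite out// normr0; lra.
  apply: (@le_trans _ _ (Kbar * L ^+ j)); last lra.
  by rewrite normrM ler_pM// pow.
- exact: out.
- apply: (@le_trans _ _ ((Lam * L ^+ j + Kbar * C) * `|u - v|)); last first.
    by rewrite ler_wpM2r//; lra.
  have n0 := normr_ge0 (u - v).
  have [uL|uL] := leP `|u| L; have [vL|vL] := leP `|v| L.
  + rewrite (_ : _ - _ = (K u - K v) * v ^+ j + K u * (u ^+ j - v ^+ j)); last by ring.
    rewrite [leRHS]mulrDl; apply: le_trans (ler_normD _ _) _; rewrite !normrM lerD//.
      by rewrite mulrAC ler_pM// pow.
    by rewrite -mulrA ler_pM// HC.
  + rewrite (out v vL) subr0; apply: le_trans (Lip1 u v uL vL) _.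
    by rewrite ler_wpM2r//; lra.
  + rewrite (out u uL) sub0r normrN; apply: le_trans (Lip1 v u vL uL) _.
    by rewrite distrC ler_wpM2r//; lra.
  + by rewrite !out// subrr normr0 mulr_ge0//; lra.
Qed.

Lemma coord_le_enorm m (v : 'rV[R]_m) k : `|v ord0 k| <= enorm v.
Proof.
rewrite -sqrtr_sqr /enorm ler_sqrt; last by rewrite sumr_ge0// => i _; exact: sqr_ge0.
by rewrite (bigD1 k)//= lerDl sumr_ge0// => i _; exact: sqr_ge0.
Qed.

(** The factor m + 1 is cruder than sqrt m but stays positive for m = 0, so [finite_cover] can
    divide by it. *)
Lemma enorm_le_coord m (v : 'rV[R]_m) (r : R) : 0 <= r ->
  (forall k, `|v ord0 k| <= r) -> enorm v <= m.+1%:R * r.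
Proof.
move=> r0 vr; have mr : 0 <= m.+1%:R * r by rewrite mulr_ge0.
rewrite -[leRHS](ger0_norm mr) -sqrtr_sqr /enorm ler_sqrt ?sqr_ge0//.
apply: (@le_trans _ _ (\sum_(k < m) r ^+ 2)).
  by apply: ler_sum => k _; rewrite -[leLHS]ger0_norm ?sqr_ge0// normrX lerXn2r// nnegrE.
rewrite sumr_const card_ord -[_ *+ m]mulr_natl exprMn ler_wpM2r ?sqr_ge0//.
by rewrite -natrX ler_nat (leq_trans (leqnSn m))// -{1}[m.+1]expn1 leq_pexp2l.
Qed.

(* The centres are taken in [S], where the moment and mixing assumptions hold. *)
Lemma finite_cover m (S : set 'rV[R]_m) (D r : R) : S !=set0 ->
  (forall g, S g -> enorm g <= D) -> 0 < r ->
  exists J : nat, J%:R <= 2 * D * m.+1%:R / r + 1 /\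
  exists ctr : {ffun 'I_m -> 'I_J} -> 'rV[R]_m, (forall k, S (ctr k)) /\
    forall g, S g -> exists k, enorm (g - ctr k) <= r.
Proof.
move=> [g0 Sg0] SD r0.
have D0 : 0 <= D by apply: le_trans (SD _ Sg0); exact: sqrtr_ge0.
pose mu := r / m.+1%:R; have mu0 : 0 < mu by rewrite divr_gt0.
pose J := (Num.truncn (2 * D / mu)).+1.
have pos (g : 'rV[R]_m) k : S g -> 0 <= (g ord0 k + D) / mu <= 2 * D / mu.
  move=> Sg; have := le_trans (coord_le_enorm g k) (SD g Sg); rewrite ler_norml => /andP[? ?].
  by apply/andP; split; [rewrite divr_ge0 ?(ltW mu0)//|rewrite ler_pM2r ?invr_gt0//]; lra.
pose cell (g : 'rV[R]_m) : {ffun 'I_m -> 'I_J} :=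
  [ffun k => inord (Num.truncn ((g ord0 k + D) / mu))].
(* A cell met by [S] is represented by one of its own points in [S], which is within [mu] of the
   others in each coordinate; [g0] fills the cells that miss [S]. *)
pose ctr (c : {ffun 'I_m -> 'I_J}) : 'rV[R]_m :=
  if pselect (exists g, S g /\ cell g = c) is left H then sval (cid H) else g0.
exists J; split.
  rewrite /J -[(Num.truncn _).+1%:R]natr1 lerD2r; have q0 : 0 <= 2 * D / mu by rewrite divr_ge0 ?mulr_ge0// ltW.
  have /andP[t1 _] := truncn_itv q0; apply: le_trans t1 _.
  by rewrite /mu invfM invrK mulrA mulrAC.
exists ctr; split=> [c|g Sg].
  by rewrite /ctr; case: pselect => [H|//]; case: (svalP (cid H)).
exists (cell g); rewrite /ctr; case: pselect => [H|]; last by case; exists g.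
case: (svalP (cid H)); set g' := sval _ => Sg' cg'.
rewrite -[r](@mulrVK _ m.+1%:R) ?unitfE// [_ * m.+1%:R]mulrC.
apply: enorm_le_coord; first exact: ltW.
move=> k; rewrite !mxE -/mu.
have /andP[p1 p2] := pos g k Sg; have /andP[p1' p2'] := pos g' k Sg'.
have : cell g' k = cell g k by rewrite cg'.
rewrite !ffunE => /(congr1 (@nat_of_ord J)); rewrite !inordK; last first.
- by rewrite ltnS; apply: le_truncn.
- by rewrite ltnS; apply: le_truncn.
have /andP[i1 i2] := truncn_itv p1; have /andP[i1' i2'] := truncn_itv p1'.
move=> e; rewrite e in i1' i2'; move: i1 i2 i1' i2'; set q := Num.truncn _; rewrite -natr1 => i1 i2 i1' i2'.
have : `|(g ord0 k + D) / mu - (g' ord0 k + D) / mu| <= 1.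
  by rewrite ler_norml; apply/andP; split; lra.
rewrite -mulrBl normrM [`|mu^-1|]gtr0_norm ?invr_gt0// ler_pdivrMr// mul1r.
by rewrite opprD addrACA subrr addr0.
Qed.

Lemma line_cover (r x : R) : 0 < r -> 0 <= x <= 1 ->
  exists l : 'I_(Num.truncn r^-1).+1, `|x - l%:R * r| <= r.
Proof.
move=> r0 /andP[x0 x1]; have q0 : 0 <= x / r by rewrite divr_ge0// ltW.
have lt : (Num.truncn (x / r) < (Num.truncn r^-1).+1)%N.
  by rewrite ltnS le_truncn// ler_piMl// invr_ge0 ltW.
exists (Ordinal lt) => /=; have /andP[i1 i2] := truncn_itv q0.
rewrite -natr1 ltr_pdivrMr// in i2; rewrite ler_pdivlMr// in i1.
by rewrite ler_norml; apply/andP; split; lra.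
Qed.

(** Puts the sum in the form of [mixing_at_window]: the window may overhang either end of 1, ..., T
    and is padded with zeros. *)
Lemma big_window (F : nat -> R) T i0 M :
  (forall i, (1 <= i <= T)%N -> ~~ (i0 <= i < i0 + M)%N -> F i = 0) ->
  \sum_(1 <= i < T.+1) F i = \sum_(i < M) (if (1 <= i0 + i <= T)%N then F (i0 + i)%N else 0).
Proof.
move=> F0; pose G i := if (1 <= i <= T)%N && (i0 <= i < i0 + M)%N then F i else 0.
pose U := (T.+1 + (i0 + M))%N.
have -> : \sum_(1 <= i < T.+1) F i = \sum_(0 <= i < U) G i.
  rewrite [RHS](@big_cat_nat _ _ _ T.+1)//=; last exact: leq_addr.
  rewrite [X in _ = _ + X]big_nat_cond [X in _ = _ + X]big1 ?addr0; last first.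
    move=> i /andP[/andP[iT _] _]; rewrite /G; case: ifP => // /andP[/andP[_]].
    by rewrite leqNgt iT.
  rewrite [RHS]big_ltn// {1}/G/= add0r; apply: eq_big_nat => i iT; rewrite /G.
  rewrite -[(i <= T)%N]ltnS iT /=; case: ifPn => // ni; apply: F0 => //.
have -> : \sum_(i < M) (if (1 <= i0 + i <= T)%N then F (i0 + i)%N else 0) =
    \sum_(i0 <= i < i0 + M) G i.
  have -> : \sum_(i0 <= i < i0 + M) G i = \sum_(0 + i0 <= i < i0 + M) G i by rewrite add0n.
  rewrite big_addn addKn big_mkord; apply: eq_bigr => i _.
  by rewrite [(i + i0)%N]addnC /G leq_addr ltn_add2l ltn_ord !andbT.
rewrite (@big_cat_nat _ _ _ i0)//=; last first.
  by rewrite /U (leq_trans (leq_addr M _))// leq_addl.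
rewrite (@big_cat_nat _ _ _ (i0 + M) i0 U)//=; [|exact: leq_addr|exact: leq_addl].
rewrite big_nat_cond big1 ?add0r; last first.
  by move=> i /andP[/andP[_ ii] _]; rewrite /G [(i0 <= i)%N]leqNgt ii/= andbF.
rewrite [X in _ + X]big_nat_cond [X in _ + X]big1 ?addr0// => i /andP[/andP[ii _] _].
by rewrite /G [(i < _)%N]ltnNge ii/= !andbF.
Qed.

End kernel.

(** * Deviation at a grid point *)

Section window.
Context {R : realType} {d : measure_display} {Omega : measurableType d}.
Variable P : probability Omega R.
Local Notation E f := (\int[P]_w f w)%R.
Local Notation L1 := (L1 P).
Local Notation Pr := (Pr P).

(** The covariance constant of the blocks with Lam^2 factored out, using 1 + Lam <= 2 Lam. The
    leading 4 rounds up 14/4, and CN + 1 comes from the number of blocks. *)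
Definition var_const (A kap s C1 CN : R) : R :=
  4 * (4 * A + 4 * (1 + 2 * (kap `^ s * C1)) ^+ 2) * (CN + 1).
(** The power of 2 is the price of an integer block length that may be as small as nu / 2. *)
Definition mix_const (A CN beta : R) : R := 2 * A * (CN + 1) * 2 `^ (1 + beta).

Lemma window_concentration (m : nat) (eps : nat -> nat -> 'rV[R]_m -> Omega -> R)
    (T : nat) (g : 'rV[R]_m) (A beta s C1 kap CN Lam N a tau nu ell : R)
    (phi : R -> R) (c : nat -> R) i0 Nw M1 :
  (forall i, measurable_fun setT (eps T i g)) ->
  0 < A -> 2 < s -> 3 / 2 * s <= beta * (s - 2) -> 0 < C1 -> 1 <= Lam ->
  (forall i, (1 <= i <= T)%N -> L1 (fun w => `|eps T i g w| `^ s)) ->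
  (forall i, (1 <= i <= T)%N -> E (fun w => `|eps T i g w| `^ s) <= C1 * (1 + Lam)) ->
  (forall k, (1 <= k)%N -> mixing_coef P eps T g k <= A * k%:R `^ (- beta)) ->
  1 <= kap -> 1 <= CN -> 0 < N -> 0 < a -> 0 < tau ->
  1 <= nu -> nu <= N -> a * tau * nu = 1 -> a ^+ 2 * N = ell ->
  measurable_fun setT phi -> (forall y, `|phi y| <= `|y|) -> (forall y, `|phi y| <= tau) ->
  (forall i, `|c i| <= kap) ->
  (forall i, (1 <= i <= T)%N -> ~~ (i0 <= i < i0 + Nw)%N -> c i = 0) ->
  Nw%:R <= CN * N -> 0 <= M1 ->
  Pr [set w | M1 * Lam * a * N <=
      `|\sum_(1 <= i < T.+1) c i * (phi (eps T i g w) - E (fun w => phi (eps T i g w)))|] <=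
  4 * (expR ((var_const A kap s C1 CN - M1 / (8 * kap)) * ell) +
       mix_const A CN beta * (N * nu `^ (- (1 + beta)))).
Proof.
move=> meps A0 s2 rho C10 Lam1 Leps Eeps mixA kap1 CN1 N0 a0 tau0 nu1 nuN atn a2N.
move=> mphi phi1 phit ck cout NwN M0.
have kap0 : 0 < kap by lra.
have Lam0 : 0 < Lam by lra.
have s0 : 0 < s by lra.
have CN0 : 0 <= CN + 1 by lra.
have nu0 : 0 < nu by lra.
pose Z i w := if (1 <= i0 + i <= T)%N then c (i0 + i)%N * phi (eps T (i0 + i) g w) else 0.
have mphie i : measurable_fun setT (fun w => phi (eps T i g w)) by exact: measurableT_comp.
have mZ i : measurable_fun setT (Z i).
  by rewrite /Z; case: (boolP (1 <= i0 + i <= T)%N) => // _; exact: measurable_funM.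
have b0 : 0 < kap * tau by rewrite mulr_gt0.
have Zb i w : `|Z i w| <= kap * tau.
  rewrite /Z; case: ifP => _; last by rewrite normr0 ltW.
  by rewrite normrM ler_pM.
pose B := kap `^ s * (C1 * (1 + Lam)).
have L10 : 0 <= 1 + Lam by rewrite addr_ge0// ltW.
have B0 : 0 <= B by rewrite !mulr_ge0 ?powR_ge0// ltW.
have EZs i : E (fun w => `|Z i w| `^ s) <= B.
  rewrite /Z; case: (boolP (1 <= i0 + i <= T)%N) => iT; last first.
    rewrite (_ : (fun w => _) = (fun=> 0)) ?E_cst//.
    by apply/funext => w; rewrite normr0 powR0 ?gt_eqF.
  apply: (@le_trans _ _ (kap `^ s * E (fun w => `|eps T (i0 + i) g w| `^ s))); last first.
    by rewrite ler_wpM2l ?powR_ge0// Eeps.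
  rewrite -EZ; last exact: Leps.
  have le w : `|c (i0 + i)%N * phi (eps T (i0 + i) g w)| `^ s <= kap `^ s * `|eps T (i0 + i) g w| `^ s.
    rewrite -powRM ?(ltW kap0)//; apply: ge0_ler_powR; rewrite ?nnegrE ?(ltW s0)//.
      by rewrite mulr_ge0 ?(ltW kap0).
    by rewrite normrM ler_pM.
  apply: E_le => //; last by apply: L1Z; exact: Leps.
  apply: (L1_le (g := fun w => kap `^ s * `|eps T (i0 + i) g w| `^ s)); last by apply: L1Z; exact: Leps.
    apply: (@measurableT_comp _ _ _ _ _ _ (fun x : R => x `^ s)) => //.
    by apply: measurableT_comp => //; exact: measurable_funM.
  by move=> w; rewrite ger0_norm ?powR_ge0.
have mixZ k : (0 < k)%N -> mixing_at P Z k (A * k%:R `^ (- beta)).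
  move=> k0; apply: (@mixing_at_window _ _ _ P m eps T g (fun i y => c (i0 + i)%N * phi y)) => //.
  - by move=> i; exact: measurable_funM.
  - exact: mixA.
  - by rewrite mulr_ge0 ?powR_ge0// ltW.
(* The block length is the integer part of [nu], which loses at most a factor 2 because [nu] is at
   least 1. *)
have nub : exists n : nat, [/\ (0 < n)%N, n%:R <= nu & nu <= 2 * n%:R].
  have /andP[t1 t2] := truncn_itv (ltW nu0).
  have n0 : (0 < Num.truncn nu)%N by rewrite truncn_gt0.
  exists (Num.truncn nu); split=> //; move: t2; rewrite -natr1.
  have : 1 <= (Num.truncn nu)%:R :> R by rewrite ler1n.
  by lra.
case: nub => n [n0 nnu nun].
have rn0 : 0 < n%:R :> R by rewrite ltr0n.
(* Enough pairs of blocks to cover the window; the extra pair is absorbed in CN + 1 because n <= nu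
   <= N. *)
pose q := (Nw %/ n.*2).+1.
have qb : q%:R <= (CN + 1) * N / n%:R.
  rewrite ler_pdivlMr// /q -natr1 mulrDl mul1r mulrDl mul1r.
  apply: lerD; last exact: le_trans nuN.
  apply: le_trans NwN; rewrite -natrM ler_nat.
  apply: leq_trans (leq_trunc_div Nw n.*2); rewrite leq_mul2l -addnn leq_addr orbT//.
have qN : (Nw <= q.*2 * n)%N.
  by rewrite -doubleMl doubleMr ltnW// ltn_ceil// double_gt0.
(* The largest value allowed for blocks bounded by 2 n kap tau, divided by [Lam] to compensate a
   variance bound that grows like Lam^2. *)
pose lam := (4 * kap * n%:R * tau * Lam)^-1.
have den0 : 0 < 4 * kap * n%:R * tau * Lam by rewrite !mulr_gt0.
have lam0 : 0 < lam by rewrite invr_gt0.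
have lamb : lam * (n%:R * (2 * (kap * tau))) <= 2^-1.
  rewrite /lam mulrC ler_pdivrMr//.
  have -> : 2^-1 * (4 * kap * n%:R * tau * Lam) = n%:R * (2 * (kap * tau)) * Lam.
    by field.
  by rewrite ler_peMr// !mulr_ge0// ltW.
have := block_bernstein mZ b0 Zb EZs A0 s2 rho mixZ q (M1 * Lam * a * N / 2) n0 lam0 lamb.
have -> : [set w | 2 * (M1 * Lam * a * N / 2) <= `|\sum_(i < q.*2 * n) (Z i w - \int[P]_x Z i x)|] =
  [set w | M1 * Lam * a * N <=
      `|\sum_(1 <= i < T.+1) c i * (phi (eps T i g w) - E (fun w => phi (eps T i g w)))|].
  apply/seteqP; suff H w : \sum_(i < q.*2 * n) (Z i w - \int[P]_x Z i x) =
      \sum_(1 <= i < T.+1) c i * (phi (eps T i g w) - E (fun w => phi (eps T i g w))).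
    by split=> w /=; rewrite H [2 * _]mulrC divfK.
  rewrite (@big_window _ _ _ i0 (q.*2 * n)); last first.
    move=> i iT ni; rewrite cout ?mul0r//; apply: contra ni => /andP[-> ii]/=.
    by apply: leq_trans ii _; rewrite leq_add2l.
  apply: eq_bigr => i _; rewrite /Z; case: ifP => _; last by rewrite E_cst subrr.
  rewrite EZ ?mulrBr//; apply: (@L1_bounded _ _ _ _ _ tau) => //.
move=> /le_trans; apply; rewrite ler_pM2l//; apply: lerD.
  rewrite ler_expR [leRHS]mulrBl [leRHS]addrC; apply: lerD.
    rewrite !mulNr lerN2 /lam -a2N.
    have -> : (4 * kap * n%:R * tau * Lam)^-1 * (M1 * Lam * a * N / 2) =
        M1 / (8 * kap) * (a * N) * (n%:R * tau)^-1.
      by field; rewrite !gt_eqF.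
    rewrite expr2 -[a * a * N]mulrA [a * (a * N)]mulrC mulrA.
    apply: ler_wpM2l; first by rewrite !mulr_ge0 ?invr_ge0 ?mulr_ge0// ltW.
    have : a * (n%:R * tau) <= 1.
      by rewrite -[leRHS]atn -mulrA ler_pM2l// mulrC ler_pM2l.
    by rewrite -ler_pdivlMr ?mulr_gt0// mul1r.
  have DD : 4 * A + 4 * (1 + B) ^+ 2 <= (4 * A + 4 * (1 + 2 * (kap `^ s * C1)) ^+ 2) * Lam ^+ 2.
    set u := kap `^ s * C1; have u0 : 0 <= u by rewrite mulr_ge0 ?powR_ge0// ltW.
    have L2 : 1 <= Lam ^+ 2 by rewrite -[1](expr1n _ 2) lerXn2r// nnegrE ltW.
    rewrite [leRHS]mulrDl; apply: lerD; first by rewrite ler_peMr// mulr_ge0// ltW.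
    rewrite -mulrA -exprMn ler_pM2l// lerXn2r// ?nnegrE; [by rewrite addr_ge0| |].
      by rewrite mulr_ge0 ?(ltW Lam0)// addr_ge0// mulr_ge0.
    by rewrite /B mulrA -/u; clear - u0 Lam1; nra.
  have CD0 : 0 <= 4 * A + 4 * (1 + 2 * (kap `^ s * C1)) ^+ 2.
    by apply: addr_ge0; apply: mulr_ge0 => //; [exact: ltW|exact: sqr_ge0].
  rewrite /var_const; set CD := 4 * A + 4 * (1 + 2 * _) ^+ 2 in DD CD0 *.
  have lL : lam * Lam <= a / 2.
    have -> : lam * Lam = (4 * kap * n%:R * tau)^-1 by rewrite /lam; field; rewrite !gt_eqF.
    rewrite -div1r ler_pdivrMr ?mulr_gt0//.
    have -> : a / 2 * (4 * kap * n%:R * tau) = kap * (a * tau * (2 * n%:R)) by field.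
    rewrite -[leLHS]mulr1 ler_pM// -[leLHS]atn ler_wpM2l// mulr_ge0// ltW//.
  have lL2 : lam ^+ 2 * Lam ^+ 2 <= a ^+ 2 / 4.
    rewrite -exprMn (_ : a ^+ 2 / 4 = (a / 2) ^+ 2); last by field.
    by rewrite lerXn2r// nnegrE ?mulr_ge0 ?divr_ge0// ltW.
  apply: (@le_trans _ _ (2 * lam ^+ 2 * (7 * (CD * Lam ^+ 2) * n%:R) * ((CN + 1) * N / n%:R))).
    have DB0 : 0 <= 4 * A + 4 * (1 + B) ^+ 2.
      by apply: addr_ge0; apply: mulr_ge0 => //; [exact: ltW|exact: sqr_ge0].
    have l20 : 0 <= lam ^+ 2 by exact: sqr_ge0.
    apply: ler_pM => //.
      by apply: mulr_ge0; [exact: mulr_ge0|apply: mulr_ge0 => //; exact: mulr_ge0].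
    by apply: ler_wpM2l; [exact: mulr_ge0|apply: ler_wpM2r => //; exact: ler_wpM2l].
  have -> : 2 * lam ^+ 2 * (7 * (CD * Lam ^+ 2) * n%:R) * ((CN + 1) * N / n%:R) =
     14 * CD * (CN + 1) * N * (lam ^+ 2 * Lam ^+ 2) by field; rewrite gt_eqF.
  have p0 : 0 <= CD * (CN + 1) * N by apply: mulr_ge0; [exact: mulr_ge0|exact: ltW].
  rewrite -a2N; have := ler_wpM2l p0 lL2; have := mulr_ge0 p0 (sqr_ge0 a); nra.
have beta0 : 0 < 1 + beta.
  have : 0 < beta * (s - 2) by apply: lt_le_trans rho; rewrite mulr_gt0.
  by rewrite pmulr_lgt0 ?subr_gt0// => ?; rewrite addr_gt0.
have nn : n%:R^-1 * n%:R `^ (- beta) <= 2 `^ (1 + beta) * nu `^ (- (1 + beta)).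
  have -> : n%:R^-1 * n%:R `^ (- beta) = n%:R `^ (- (1 + beta)).
    by rewrite opprD powR_addp// powR_inv1.
  rewrite !powRN ler_pdivlMr ?powR_gt0// ler_pdivrMl ?powR_gt0// -powRM//.
  by apply: ge0_ler_powR; rewrite ?nnegrE ?(ltW beta0) ?(ltW nu0)// mulrC.
apply: (@le_trans _ _ (2 * ((CN + 1) * N / n%:R) * (A * n%:R `^ (- beta)))).
  by rewrite ler_wpM2r ?mulr_ge0 ?powR_ge0 ?(ltW A0)// ler_wpM2l.
have -> : 2 * ((CN + 1) * N / n%:R) * (A * n%:R `^ (- beta)) =
  2 * A * (CN + 1) * N * (n%:R^-1 * n%:R `^ (- beta)) by ring.
rewrite /mix_const.
have -> : 2 * A * (CN + 1) * 2 `^ (1 + beta) * (N * nu `^ (- (1 + beta))) =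
  2 * A * (CN + 1) * N * (2 `^ (1 + beta) * nu `^ (- (1 + beta))) by ring.
apply: ler_wpM2l => //; apply: mulr_ge0; last exact: ltW.
by apply: mulr_ge0 => //; apply: mulr_ge0 => //; exact: ltW.
Qed.
End window.

(** * Rates *)

Section asymptotics.
Context {R : realType}.

(* Here [l], [ll], [lh], [lw], [lH], [lnu] stand for the logarithms of T, ln T, h,
   ln T / (T^theta h), H and nu; the coefficient of [l] in the last bound is
   a multiple of [theta * denominator - numerator], which is 0 by definition of [theta]. *)
Lemma rate_exponents (s beta c mR theta l ll lh lw lH lnu : R) :
  2 < s -> 2 < beta -> 0 < c -> 0 <= mR ->
  theta = (beta * (s - 2) - mR * (s - 1) * (1 + 2 * c) - 2 * s + 1) / (beta * s + mR * (s - 1) + 1) ->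
  0 <= l -> 0 <= ll -> lw <= 0 ->
  lw = ll - (theta * l + lh) -> lH = (l - (lh + ll)) / 2 -> lnu = lh + (s - 2) / (s - 1) * lH ->
  0 <= lnu /\
  c * mR * l + (mR + 1) * lH + (l + lh) - (1 + beta) * lnu <= beta / 2 * lw.
Proof.
move=> s2 b2 c0 m0 th l0 ll0 lw0 Ew EH Enu.
have s10 : 0 < s - 1 by lra.
have q0 : 0 <= mR * (s - 1) by rewrite mulr_ge0//; lra.
have den0 : 0 < beta * s + mR * (s - 1) + 1 by nra.
have thE : theta * (beta * s + mR * (s - 1) + 1) = beta * (s - 2) - mR * (s - 1) * (1 + 2 * c) - 2 * s + 1.
  by rewrite th divfK// gt_eqF.
(* Makes the coefficient of [l] in [lnu] nonnegative; together with lw <= 0 this forces the block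
   length to be at least 1. *)
have ths : theta * s <= s - 2.
  rewrite -(ler_pM2r den0) mulrAC thE.
  have : 0 <= mR * (s - 1) * c by rewrite mulr_ge0// ltW.
  by nra.
have lhE : lh = ll - theta * l - lw by rewrite Ew; ring.
pose p1 := (s - 2) / (s - 1).
have p10 : 0 <= p1 by rewrite divr_ge0//; lra.
have p11 : p1 <= 1 by rewrite ler_pdivrMr//; lra.
have nuE : lnu = l * ((s - 2 - theta * s) / (2 * (s - 1))) + ll * (1 - p1) + (- lw) * (1 - p1 / 2).
  by rewrite Enu EH lhE /p1; field; rewrite gt_eqF.
split.
  rewrite nuE !addr_ge0// mulr_ge0//.
  - by rewrite divr_ge0//; lra.
  - by rewrite subr_ge0.
  - by rewrite oppr_ge0.
  - by lra.
(* [- p] is the coefficient of [lH] once [lnu] is expanded. Since p1 <= 1 gives p <= beta, the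
   nonpositive [lw] keeps a coefficient of at least beta / 2. *)
pose p := (1 + beta) * p1 - (mR + 1).
have pb : p <= beta by rewrite /p; nra.
have -> : c * mR * l + (mR + 1) * lH + (l + lh) - (1 + beta) * lnu =
   (beta - p / 2) * lw + (p - beta) * ll +
   (theta * (beta * s + mR * (s - 1) + 1) - (beta * (s - 2) - mR * (s - 1) * (1 + 2 * c) - 2 * s + 1))
     / (2 * (s - 1)) * l.
  by rewrite Enu EH lhE /p /p1; field; rewrite gt_eqF.
rewrite thE subrr !mul0r addr0.
have : (p - beta) * ll <= 0 by rewrite mulr_le0_ge0//; lra.
have : (beta - p / 2) * lw <= beta / 2 * lw.
  by rewrite ler_wnM2r//; lra.
lra.
Qed.

(** theta <= 1 gives a <= 1, while T h >= 1 and ln T >= 1 give H <= T and nu <= T h. The lower bound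
    on [nu] and the last inequality are read off in logarithms. *)
Lemma rate_facts (h ell T s beta c theta : R) (m : nat) :
  2 < s -> 2 < beta -> 0 < c -> theta = theta_of beta m s c -> theta <= 1 ->
  0 < h -> h <= 1 -> 1 <= T -> 1 <= T * h -> 1 <= ell -> ell = ln T ->
  ell / (T `^ theta * h) <= 1 ->
  let a := Num.sqrt (ell / (T * h)) in
  let H := (h * a)^-1 in
  let tau := H `^ (s - 1)^-1 in
  let nu := (a * tau)^-1 in
  [/\ [/\ 0 < a, a <= 1, 1 <= H & H <= T], [/\ 1 <= tau, 1 <= nu & nu <= T * h] &
   (T `^ (c * m%:R) * H ^+ m.+1) * (T * h * nu `^ (- (1 + beta))) <=
     (ell / (T `^ theta * h)) `^ (beta / 2)].
Proof.
move=> s2 b2 c0 th th1 h0 h1 T1 N1 l1 lE w1 a H tau nu.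
have T0 : 0 < T by lra. have l0 : 0 < ell by lra. have N0 : 0 < T * h by lra.
have s10 : 0 < s - 1 by lra.
have Tth0 : 0 < T `^ theta by rewrite powR_gt0.
set w := ell / (T `^ theta * h); have w0 : 0 < w by rewrite divr_gt0 ?mulr_gt0.
have a20 : 0 < ell / (T * h) by rewrite divr_gt0.
have a0 : 0 < a by rewrite sqrtr_gt0.
have a2 : a ^+ 2 = ell / (T * h) by rewrite sqr_sqrtr// ltW.
have a1 : a <= 1.
  rewrite -[1]sqrtr1 ler_sqrt//; apply: le_trans w1.
  rewrite ler_pM2l// lef_pV2 ?posrE ?mulr_gt0// ler_pM2r//.
  by rewrite -[leRHS]powRr1 ?ler_powR// ltW.
have ha0 : 0 < h * a by rewrite mulr_gt0.
have H0 : 0 < H by rewrite invr_gt0.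
have H1 : 1 <= H by rewrite invf_ge1// mulr_ile1// ltW.
have HT : H <= T.
  rewrite /H invf_ple ?posrE// -(@ler_pXn2r _ 2)// ?nnegrE ?invr_ge0 ?(ltW T0) ?(ltW ha0)//.
  rewrite exprMn a2 exprVn; rewrite (_ : h ^+ 2 * _ = h * ell / T); last first.
    by field; rewrite !gt_eqF.
  rewrite -div1r ler_pdivrMr ?exprn_gt0// (_ : _ * T ^+ 2 = T * h * ell); last first.
    by field; rewrite gt_eqF.
  by rewrite -[leLHS]mulr1 ler_pM.
have tau0 : 0 < tau by rewrite powR_gt0.
have tau1 : 1 <= tau.
  by rewrite /tau -[leLHS](powRr0 H) ler_powR// invr_ge0 ltW.
have nu0 : 0 < nu by rewrite invr_gt0 mulr_gt0.
have nuN : nu <= T * h.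
  rewrite /nu invf_ple ?posrE ?mulr_gt0//; apply: (@le_trans _ _ a); last by rewrite ler_peMr// ltW.
  rewrite -div1r ler_pdivrMr// -(@ler_pXn2r _ 2)// ?nnegrE ?mulr_ge0 ?(ltW N0) ?(ltW a0) ?(ltW T0) ?(ltW h0)//.
  rewrite expr1n exprMn a2 (_ : ell / (T * h) * (T * h) ^+ 2 = ell * (T * h)); last by field; rewrite !gt_eqF.
  by rewrite -[leLHS]mulr1 ler_pM.
have Ew : ln w = ln ell - (theta * ln T + ln h).
  by rewrite /w ln_div ?posrE ?mulr_gt0// lnM ?posrE// ln_powR.
have la : ln a = (ln ell - (ln T + ln h)) / 2.
  rewrite -lnM ?posrE// -ln_div ?posrE// -a2 lnXn//.
  by rewrite -[ln a *+ 2]mulr_natr mulfK.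
have EH : ln H = (ln T - (ln h + ln ell)) / 2.
  by rewrite /H lnV ?posrE// lnM ?posrE// la; field.
have Enu : ln nu = ln h + (s - 2) / (s - 1) * ln H.
  rewrite /nu lnV ?posrE ?mulr_gt0// lnM ?posrE// /tau ln_powR.
  have -> : ln a = - ln H - ln h by rewrite /H lnV ?posrE// lnM ?posrE//; ring.
  by field; rewrite gt_eqF.
have lT0 : 0 <= ln T by rewrite -lE ltW.
have ll0 : 0 <= ln ell by exact: ln_ge0.
have lw0 : ln w <= 0 by rewrite -ln1 ler_ln ?posrE.
have [nu1 Q] := rate_exponents s2 b2 c0 (ler0n R m) th lT0 ll0 lw0 Ew EH Enu.
split; [by []|split=> //; by rewrite -ler_ln ?posrE// ln1|].
have NuP : 0 < nu `^ (- (1 + beta)) by rewrite powR_gt0.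
rewrite -ler_ln ?posrE ?powR_gt0// ?mulr_gt0 ?exprn_gt0 ?powR_gt0//.
rewrite lnM ?posrE ?mulr_gt0 ?exprn_gt0 ?powR_gt0// lnM ?posrE ?exprn_gt0 ?powR_gt0//.
rewrite lnM ?posrE ?mulr_gt0// lnM ?posrE// !ln_powR lnXn//.
rewrite -[ln H *+ _]mulr_natl -[m.+1%:R]natr1 mulNr addrA//.
Qed.
End asymptotics.

(** * Uniform deviation *)

Section outer.
Context {R : realType} {d : measure_display} {Omega : measurableType d}.
Variable P : probability Omega R.
Local Notation E f := (\int[P]_w f w)%R.
Local Notation L1 := (L1 P).
Local Notation Pr := (Pr P).

Lemma markov_ereal (f : Omega -> \bar R) (c M : R) : measurable_fun setT f ->
  (forall w, 0 <= f w)%E -> (\int[P]_w f w <= c%:E)%E -> 0 < M ->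
  Pr [set w | (M%:E <= f w)%E] <= c / M.
Proof.
move=> mf f0 fc M0.
have mA : measurable [set w | (M%:E <= f w)%E].
  by rewrite -[X in measurable X]setTI; exact: emeasurable_fun_c_infty.
rewrite ler_pdivlMr// mulrC -lee_fin EFinM -PrE//; apply: le_trans fc.
rewrite -integral_cst//.
apply: (@le_trans _ _ (\int[P]_(w in [set w | (M%:E <= f w)%E]) f w)%E).
  apply: ge0_le_integral => //.
  - by move=> w _; rewrite lee_fin ltW.
  - exact: measurable_funTS.
by apply: ge0_subset_integral.
Qed.

(** The infimum defining [outerE] need not be attained, whence c + 1: each [f i] gets a measurable
    majorant with integral at most c + 1, and Markov is applied to their sum. The exceptional set is
    fixed before [v], so it serves every gamma at once. *)
Lemma outer_markov (T : nat) (f : nat -> Omega -> \bar R) (c M : R) :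
  (0 < T)%N -> (forall i w, (1 <= i <= T)%N -> 0 <= f i w)%E -> 0 <= c ->
  (forall i, (1 <= i <= T)%N -> outerE P (f i) <= c%:E)%E -> 0 < M ->
  exists A, [/\ measurable A, Pr A <= (c + 1) / M & forall w, ~ A w ->
    forall v : nat -> R, (forall i, (1 <= i <= T)%N -> ((v i)%:E <= f i w)%E) ->
      \sum_(1 <= i < T.+1) v i <= T%:R * M].
Proof.
move=> T0 f0 c0 fc M0.
have T0' : 0 < T%:R :> R by rewrite ltr0n.
have H i : exists g : Omega -> \bar R, [/\ measurable_fun setT g, (forall w, 0 <= g w)%E,
    (\int[P]_w g w <= (c + 1)%:E)%E & (1 <= i <= T)%N -> forall w, (f i w <= g w)%E].
  (* Outside 1, ..., T the zero function is a placeholder, so that [choice] applies to all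
     indices. *)
  case: (boolP (1 <= i <= T)%N) => iT; last first.
    by exists (cst 0%E); split=> //; rewrite integral0 lee_fin addr_ge0.
  have : (outerE P (f i) < (c + 1)%:E)%E by apply: le_lt_trans (fc i iT) _; rewrite lte_fin ltrDl.
  case/ereal_inf_lt => _ [g [mg fg] <-] gc; exists g; split=> //; last exact: ltW.
  by move=> w; apply: le_trans (fg w); exact: f0.
have [g Hg] := choice H.
pose S w := (\sum_(1 <= i < T.+1) g i w)%E.
have mg i : measurable_fun setT (g i) by case: (Hg i).
have g0 i w : (0 <= g i w)%E by case: (Hg i).
exists [set w | ((T%:R * M)%:E <= S w)%E]; split.
- rewrite -[X in measurable X]setTI; apply: emeasurable_fun_c_infty => //.
  exact: emeasurable_sum.
- rewrite (_ : (c + 1) / M = (T%:R * (c + 1)) / (T%:R * M)); last first.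
    by field; rewrite !gt_eqF.
  apply: markov_ereal; last by rewrite mulr_gt0.
  + exact: emeasurable_sum.
  + by move=> w; apply: sume_ge0.
  + rewrite ge0_integral_sum//; apply: (@le_trans _ _ (\sum_(1 <= i < T.+1) (c + 1)%:E)%E).
      by apply: lee_sum => i _; case: (Hg i).
    by rewrite sumEFin lee_fin sumr_const_nat subn1 mulr_natl.
- move=> w /= /negP; rewrite -ltNge => Sw v vf.
  rewrite -lee_fin; apply: le_trans (ltW Sw); rewrite -sumEFin /S.
  rewrite big_nat_cond [leRHS]big_nat_cond; apply: lee_sum => i /andP[iT _].
  by case: (Hg i) => _ _ _ H'; apply: le_trans (vf i iT) _; exact: H'.
Qed.

Lemma moment_L1 (f : Omega -> R) (s c : R) : measurable_fun setT f -> 1 <= s ->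
  (\int[P]_w (`|f w| `^ s)%:E <= c%:E)%E ->
  [/\ L1 (fun w => `|f w| `^ s), E (fun w => `|f w| `^ s) <= c, L1 f & E (fun w => `|f w|) <= 1 + c].
Proof.
move=> mf s1 fc.
have Ls : L1 (fun w => `|f w| `^ s).
  apply/integrableP; split.
    apply/measurable_EFinP; apply: (@measurableT_comp _ _ _ _ _ _ (fun x : R => x `^ s)) => //.
    exact: measurableT_comp.
  apply: le_lt_trans (ltry c); apply: le_trans fc.
  by under eq_integral do rewrite /= ger0_norm ?powR_ge0//.
have Es : E (fun w => `|f w| `^ s) <= c.
  rewrite -lee_fin fineK//; apply: integrable_fin_num => //.
have L1s : L1 (fun w => 1 + `|f w| `^ s) by apply: L1D => //; exact: L1_cst.
have Lf : L1 f by apply: (L1_le (g := fun w => 1 + `|f w| `^ s)) => // w; exact: abs_le_1powR.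
split=> //; apply: (@le_trans _ _ (E (fun w => 1 + `|f w| `^ s))).
  by apply: E_le => //; [exact: L1_abs|move=> w; exact: abs_le_1powR].
by rewrite ED ?E_cst ?lerD2l//; exact: L1_cst.
Qed.

Lemma normr_chain (a b c e : R) : `|a| <= `|a - b| + `|b - c| + `|c - e| + `|e|.
Proof.
have t (u v : R) : `|u| <= `|u - v| + `|v| by rewrite -{1}(subrK v u) ler_normD.
by have := t a b; have := t b c; have := t c e; lra.
Qed.

Lemma lt_normr_dist (u v r e : R) : `|u - v| <= e -> r + e < `|u| -> r < `|v|.
Proof. by have := ler_normD (u - v) v; rewrite subrK; lra. Qed.

(** The Lipschitz condition holds only almost surely; multiplying by the indicator of the good set
    gives a pointwise bound and leaves the expectations unchanged. *)
Lemma E_ae_le (f g : Omega -> R) N : L1 f -> L1 g -> measurable N -> P N = 0%E ->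
  (forall w, ~ N w -> `|f w| <= g w) -> `|E f| <= E g.
Proof.
move=> lf lg mN PN fg.
have mind : measurable_fun setT (fun w => \1_(~` N) w : R).
  by apply: measurable_indic; exact: measurableC.
have H (u : Omega -> R) : L1 u -> L1 (fun w => u w * \1_(~` N) w) /\ E u = E (fun w => u w * \1_(~` N) w).
  move=> lu; have lu' : L1 (fun w => u w * \1_(~` N) w).
    apply: (L1_le (g := fun w => `|u w|)); last exact: L1_abs.
      by apply: measurable_funM => //; exact: L1_measurable lu.
    move=> w; rewrite normrM indicE; case: (_ \in _); rewrite ?normr1 ?mulr1//.
    by rewrite normr0 mulr0.
  split=> //; congr fine; apply: ae_eq_integral => //.
  - exact/measurable_EFinP/L1_measurable/lu.
  - exact/measurable_EFinP/L1_measurable/lu'.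
  - exists N; split=> // w /=; apply: contra_notP => Nw _.
    by rewrite indicE mem_set// mulr1.
have [lf' ->] := H f lf; have [lg' ->] := H g lg.
apply: E_abs_le => // w; rewrite normrM indicE; case: (boolP (w \in ~` N)); last by rewrite normr0 !mulr0.
by rewrite inE => /fg; rewrite normr1 !mulr1.
Qed.

Lemma E_sum_nat T (F : nat -> Omega -> R) : (forall i, (1 <= i <= T)%N -> L1 (F i)) ->
  E (fun w => \sum_(1 <= i < T.+1) F i w) = \sum_(1 <= i < T.+1) E (F i).
Proof.
move=> lF; pose G i := if (1 <= i <= T)%N then F i else fun=> 0.
have lG i : L1 (G i).
  by rewrite /G; case: (boolP (1 <= i <= T)%N) => [|_]; [exact: lF|exact: L1_cst].
transitivity (E (fun w => \sum_(1 <= i < T.+1) G i w)).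
  by apply: eqE => w; apply: eq_big_nat => i; rewrite ltnS /G => ->.
rewrite E_sum//; apply: eq_big_nat => i; rewrite ltnS /G => ->//.
Qed.

Lemma L1_sum_nat T (F : nat -> Omega -> R) : (forall i, (1 <= i <= T)%N -> L1 (F i)) ->
  L1 (fun w => \sum_(1 <= i < T.+1) F i w).
Proof.
move=> lF; pose G i := if (1 <= i <= T)%N then F i else fun=> 0.
have lG i : L1 (G i).
  by rewrite /G; case: (boolP (1 <= i <= T)%N) => [|_]; [exact: lF|exact: L1_cst].
rewrite (_ : (fun w => _) = fun w => \sum_(1 <= i < T.+1) G i w); first exact: L1_sum.
by apply/funext => w; apply: eq_big_nat => i; rewrite ltnS /G => ->.
Qed.

(** Used twice: for moving gamma, with [xi] as [x], and for truncation, with the s-th power of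
    |eps|. The means inherit the pointwise bound by integration, hence the second sum. *)
Lemma weighted_diff T (c y y' x ey ey' ex : nat -> R) (k r : R) :
  (forall i, `|c i| <= k) ->
  (forall i, (1 <= i <= T)%N -> `|y i - y' i| <= r * x i) ->
  (forall i, (1 <= i <= T)%N -> `|ey i - ey' i| <= r * ex i) ->
  `|\sum_(1 <= i < T.+1) c i * (y i - ey i) - \sum_(1 <= i < T.+1) c i * (y' i - ey' i)| <=
  k * r * (\sum_(1 <= i < T.+1) x i + \sum_(1 <= i < T.+1) ex i).
Proof.
move=> ck yx eyx; rewrite -sumrB -big_split/= mulr_sumr.
apply: le_trans (ler_norm_sum _ _ _) _.
rewrite big_nat_cond [leRHS]big_nat_cond; apply: ler_sum => i /andP[iT _].
rewrite -mulrBr normrM -mulrA; apply: ler_pM => //.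
rewrite (_ : _ - _ = (y i - y' i) - (ey i - ey' i)); last by ring.
by apply: le_trans (ler_normB _ _) _; rewrite mulrDr lerD ?yx ?eyx.
Qed.

(** The change is at most the sum of k W (|z| + az). Writing |z| + az as |z| - az plus 2 az isolates
    a centred sum, which concentrates like the main term, and a deterministic remainder. *)
Lemma weight_change T (c c' z ez az W : nat -> R) (k e : R) : 0 <= k ->
  (forall i, `|c i - c' i| <= k * W i) ->
  (forall i, 0 <= W i) -> (forall i, `|ez i| <= az i) ->
  (forall i, (1 <= i <= T)%N -> az i <= e) ->
  `|\sum_(1 <= i < T.+1) c i * (z i - ez i) - \sum_(1 <= i < T.+1) c' i * (z i - ez i)| <=
  k * (`|\sum_(1 <= i < T.+1) W i * (`|z i| - az i)| + 2 * e * \sum_(1 <= i < T.+1) W i).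
Proof.
move=> k0 cW W0 eza aze; rewrite -sumrB.
apply: (@le_trans _ _ (k * (\sum_(1 <= i < T.+1) W i * (`|z i| - az i) + 2 * e * \sum_(1 <= i < T.+1) W i))); last first.
  by rewrite ler_wpM2l// lerD2r ler_norm.
rewrite mulr_sumr -big_split/= mulr_sumr; apply: le_trans (ler_norm_sum _ _ _) _.
rewrite big_nat_cond [leRHS]big_nat_cond; apply: ler_sum => i /andP[iT _].
rewrite -mulrBl normrM.
apply: (@le_trans _ _ (k * W i * (`|z i| + az i))).
  apply: ler_pM => //; apply: le_trans (ler_normB _ _) _; exact: lerD.
rewrite -mulrA ler_wpM2l// [2 * e * _]mulrC -mulrDr ler_wpM2l//.
by have := aze i iT; lra.
Qed.

End outer.

(** * The uniform deviation bound at a fixed sample size *)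

Section fixedT.
Context {R : realType} {d : measure_display} {Omega : measurableType d}.
Variable P : probability Omega R.
Local Notation E f := (\int[P]_w f w)%R.
Local Notation L1 := (L1 P).
Local Notation Pr := (Pr P).

Lemma outerP_le (A B : set Omega) (r : R) : measurable A -> B `<=` A -> Pr A <= r ->
  (outerP P B <= r%:E)%E.
Proof.
move=> mA BA Ar; apply: (@le_trans _ _ (P A)); last by rewrite PrE ?lee_fin.
by apply: ereal_inf_lbound; exists A.
Qed.

(** The summands are the costs of moving gamma and truncating, of moving [x], and of the deviation
    at the grid point itself. *)
Definition dev_const (kap M M1 C1 C2 L : R) : R :=
  kap * (2 + 2 * M + 2 * C2 + 2 * C1) + kap * (M1 + 2 * (1 + 2 * C1) * (2 * L + 4)) + M1.

(* Bounds the number of grid points of [0,1] x {|gamma| <= D} at mesh 1/H. *)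
Definition grid_const (m : nat) (H D : R) : R := 2 * H * ((2 * m%:R + 3) * D * H) ^+ m.

(** A large supremum forces one of four events: failure of the Lipschitz condition, a large average
    of measurable majorants of the suprema of |eps|^s or of |xi|^s, or a deviation at some grid
    point. The factor 8 is 4 for the kernel weights plus 4 for the window weights. *)
Lemma uniform_deviation_outerP m (Theta : set 'rV[R]_m)
    (eps xi : nat -> nat -> 'rV[R]_m -> Omega -> R)
    (h : nat -> R) (K : R -> R) (j T : nat)
    (s beta A C1 C2 C kap L D Lam a H tau nu ell M M1 : R) :
  (0 < T)%N ->
  (forall i g, Theta g -> measurable_fun setT (eps T i g)) ->
  (forall i g, Theta g -> measurable_fun setT (xi T i g)) ->
  (forall i g w, 0 <= xi T i g w) ->
  (forall i, (1 <= i <= T)%N ->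
     {ae P, forall w, forall g g', Theta g -> Theta g' -> enorm (g' - g) <= h T ->
        `|eps T i g' w - eps T i g w| <= xi T i g w * enorm (g' - g)}) ->
  (forall i g, (1 <= i <= T)%N -> Theta g -> enorm g <= D ->
    (\int[P]_w ((`|eps T i g w| `^ s)%:E) <= (C1 * (1 + Lam))%:E)%E /\
    (\int[P]_w ((`|xi T i g w| `^ s)%:E) <= (C2 * (1 + Lam))%:E)%E) ->
  (forall k g, (1 <= k)%N -> Theta g -> mixing_coef P eps T g k <= A * k%:R `^ (- beta)) ->
  let S := [set g | Theta g /\ enorm g <= D] in
  (forall i, (1 <= i <= T)%N ->
    (outerE P (fun w => ereal_sup [set (`|eps T i g w| `^ s)%:E | g in S]) <= (C * (1 + Lam))%:E)%E /\
    (outerE P (fun w => ereal_sup [set (`|xi T i g w| `^ s)%:E | g in S]) <= (C * (1 + Lam))%:E)%E) ->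
  1 <= kap -> 1 <= L -> (forall u, `|K u * u ^+ j| <= kap) ->
  (forall u, L < `|u| -> K u * u ^+ j = 0) ->
  (forall u v, `|K u * u ^+ j - K v * v ^+ j| <= kap * `|u - v|) ->
  0 < A -> 2 < s -> 3 / 2 * s <= beta * (s - 2) -> 0 < C1 -> 0 < C2 -> 0 < C ->
  1 <= Lam -> 1 <= D -> 0 < h T -> 1 <= T%:R * h T ->
  0 < a -> a <= 1 -> H = (h T * a)^-1 -> 1 <= H -> tau = H `^ (s - 1)^-1 -> 0 < tau ->
  1 <= nu -> nu <= T%:R * h T -> a * tau * nu = 1 -> a ^+ 2 * (T%:R * h T) = ell ->
  0 < M -> 0 <= M1 ->
  (outerP P [set w | ((dev_const kap M M1 C1 C2 L * (Lam * a))%:E <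
        ereal_sup [set (`| Psi_hat eps K h j T z.1 z.2 w - EPsi_hat P eps K h j T z.1 z.2 |)%:E
                  | z in (`[0%R, 1%R]%classic : set R) `*` S])%E]
  <= (2 * ((2 * C + 1) / M) + grid_const m H D *
     (8 * (expR ((var_const A kap s C1 (2 * L + 4) - M1 / (8 * kap)) * ell) +
       mix_const A (2 * L + 4) beta * (T%:R * h T * nu `^ (- (1 + beta)))))%R)%:E)%E.
Proof.
move=> T0 meps mxi xi0 aeLip mom mixA S out kap1 L1' Kk Kout KLip A0 s2 rho C10 C20 C0 Lam1 D1 h0 N1.
move=> a0 a1 HE H1 tauE tau0 nu1 nuN atn a2N M0 M10.
set N := T%:R * h T in N1 nuN a2N *.
set pb := expR _ + _.
have N0 : 0 < N by exact: lt_le_trans N1.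
have T0' : 0 < T%:R :> R by rewrite ltr0n.
have Lam0 : 0 < Lam by exact: lt_le_trans Lam1.
have kap0 : 0 < kap by exact: lt_le_trans kap1.
have H0 : 0 < H by exact: lt_le_trans H1.
have L0 : 0 < L by exact: lt_le_trans L1'.
have ha0 : 0 < h T * a by rewrite mulr_gt0.
have pb0 : 0 <= pb.
  have CN0 : 0 <= 2 * L + 4 + 1 by clear - L0; lra.
  apply: addr_ge0; first exact: expR_ge0.
  apply: mulr_ge0; last by apply: mulr_ge0; [exact: ltW|exact: powR_ge0].
  apply: mulr_ge0; last exact: powR_ge0.
  by apply: mulr_ge0 => //; apply: mulr_ge0 => //; exact: ltW.
have g0 : 0 <= grid_const m H D.
  have m0 : 0 <= 2 * m%:R + 3 :> R by rewrite addr_ge0 ?mulr_ge0.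
  apply: mulr_ge0; first by rewrite mulr_ge0// ltW.
  by apply: exprn_ge0; apply: mulr_ge0; [apply: mulr_ge0 => //; exact: le_trans D1|exact: ltW].
(* For empty [S] the supremum is minus infinity and the event is empty. *)
have [Sne|S0] := pselect (S !=set0); last first.
  apply: (@outerP_le set0) => //.
    move=> w /=; rewrite (_ : image _ _ = set0) ?ereal_sup0 ?ltNge ?leNye//.
    by apply/seteqP; split=> // y [[x g] [_ Sg] _]; case: S0; exists g.
  rewrite /Pr measure0/= addr_ge0//; last by rewrite mulr_ge0// mulr_ge0.
  by rewrite mulr_ge0// divr_ge0 ?addr_ge0 ?mulr_ge0 ?ltW.
have r0 := ha0.
have [J [Jb [ctr [Sctr cov]]]] := finite_cover Sne (fun g Sg => Sg.2) r0.
pose cc (x : R) (i : nat) := K ((i%:R / T%:R - x) / h T) * ((i%:R / T%:R - x) / h T) ^+ j.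
(* Indicator weights; the radius L + 1 leaves room for moving [x] to the grid, which shifts the
   argument by at most a <= 1. *)
pose W (x : R) (i : nat) : R := if `|(i%:R / T%:R - x) / h T| <= L + 1 then 1 else 0.
pose phi (y : R) := if `|y| <= tau then y else 0.
pose nx := (Num.truncn (h T * a)^-1).+1.
pose X (l : 'I_nx) : R := l%:R * (h T * a).
have mphi : measurable_fun setT phi.
  by apply: measurable_fun_ifT => //; apply: measurable_fun_ler => //; exact: measurableT_comp.
have phi1 y : `|phi y| <= `|y| by rewrite /phi; case: ifP => // _; rewrite normr0.
have phit y : `|phi y| <= tau by rewrite /phi; case: ifP => // _; rewrite normr0 ltW.
have s1 : 1 <= s by clear - s2; lra.
have mom' i g : (1 <= i <= T)%N -> S g ->
    [/\ L1 (fun w => `|eps T i g w| `^ s), E (fun w => `|eps T i g w| `^ s) <= C1 * (1 + Lam),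
      L1 (eps T i g), E (fun w => `|eps T i g w|) <= 1 + C1 * (1 + Lam) &
      L1 (xi T i g) /\ E (xi T i g) <= 1 + C2 * (1 + Lam)].
  move=> iT [Tg gD]; have [m1 m2] := mom i g iT Tg gD.
  have [? ? ? ?] := moment_L1 (meps i g Tg) s1 m1.
  have [_ _ ? xx] := moment_L1 (mxi i g Tg) s1 m2.
  split=> //; split=> //; apply: le_trans xx.
  by apply: E_le => //; [exact: L1_abs|move=> w; rewrite ger0_norm].
have c0 : 0 <= C * (1 + Lam) by rewrite mulr_ge0 ?addr_ge0// ltW.
have ML0 : 0 < M * Lam by rewrite mulr_gt0.
have sup0 (f : nat -> nat -> 'rV[R]_m -> Omega -> R) i w : (0 <= ereal_sup [set (`|f T i g w| `^ s)%:E | g in S])%E.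
  case: Sne => g Sg; apply: (@le_trans _ _ (`|f T i g w| `^ s)%:E); first by rewrite lee_fin powR_ge0.
  by apply: ereal_sup_ubound; exists g.
have [A1 [mA1 PA1 HA1]] := outer_markov (f := fun i w => ereal_sup [set (`|eps T i g w| `^ s)%:E | g in S])
  T0 (fun i w _ => sup0 eps i w) c0 (fun i iT => (out i iT).1) ML0.
have [A2 [mA2 PA2 HA2]] := outer_markov (f := fun i w => ereal_sup [set (`|xi T i g w| `^ s)%:E | g in S])
  T0 (fun i w _ => sup0 xi i w) c0 (fun i iT => (out i iT).2) ML0.
(* The null set depends on [i] but not on gamma, because the quantifier over gamma is inside the
   almost sure statement. *)
have HNl i : exists B : set Omega, [/\ measurable B, P B = 0%E &
    (1 <= i <= T)%N -> forall w, ~ B w -> forall g g', Theta g -> Theta g' -> enorm (g' - g) <= h T ->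
        `|eps T i g' w - eps T i g w| <= xi T i g w * enorm (g' - g)].
  case: (boolP (1 <= i <= T)%N) => iT; last by exists set0; rewrite measure0.
  have [B [mB PB sB]] := aeLip i iT; exists B; split=> // _ w nB.
  by apply: contrapT => nH; apply: nB; exact: sB.
have [Nl HN] := choice HNl.
pose A0' := \big[setU/set0]_(1 <= i < T.+1) Nl i.
pose A3 (p : 'I_nx * {ffun 'I_m -> 'I_J}) := [set w | M1 * Lam * a * N <=
   `|\sum_(1 <= i < T.+1) cc (X p.1) i * (phi (eps T i (ctr p.2) w) - E (fun w => phi (eps T i (ctr p.2) w)))|].
pose A4 (p : 'I_nx * {ffun 'I_m -> 'I_J}) := [set w | M1 * Lam * a * N <=
   `|\sum_(1 <= i < T.+1) W (X p.1) i * (`|phi (eps T i (ctr p.2) w)| - E (fun w => `|phi (eps T i (ctr p.2) w)|))|].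
pose A5 := \big[setU/set0]_(p : 'I_nx * {ffun 'I_m -> 'I_J}) (A3 p `|` A4 p).
have mdev (c : nat -> R) (f : R -> R) g (e : nat -> R) (r : R) : Theta g -> measurable_fun setT f ->
   measurable [set w | r <= `|\sum_(1 <= i < T.+1) c i * (f (eps T i g w) - e i)|].
  move=> Tg mf; rewrite -[X in measurable X]setTI; apply: measurable_fun_le => //.
  apply: measurableT_comp => //; apply: measurable_sum => i.
  apply: measurable_funM => //; apply: measurable_funB => //.
  by apply: measurableT_comp => //; exact: meps.
have mabsphi : measurable_fun setT (fun y => `|phi y|) by exact: measurableT_comp.
have mA3 p : measurable (A3 p) by apply: mdev => //; exact: (Sctr p.2).1.
have mA4 p : measurable (A4 p).
  by apply: (mdev _ (fun y => `|phi y|)) => //; exact: (Sctr p.2).1.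
have mA0 : measurable A0' by apply: bigsetU_measurable => i _; case: (HN i).
have mA5 : measurable A5 by apply: bigsetU_measurable => p _; exact: measurableU.
pose i0 (x : R) := Num.truncn (T%:R * (x - (L + 1) * h T)).
(* The two extra indices absorb the two integer parts taken here and in [i0]. *)
pose Nw := (Num.truncn (2 * (L + 1) * N)).+2.
have win x i : (1 <= i <= T)%N -> ~~ (i0 x <= i < i0 x + Nw)%N -> L + 1 < `|(i%:R / T%:R - x) / h T|.
  move=> iT; apply: contraR; rewrite -leNgt normrM [`|(h T)^-1|]gtr0_norm ?invr_gt0//.
  rewrite ler_pdivrMr// ler_norml => /andP[w1 w2].
  have E1 : i%:R = T%:R * (i%:R / T%:R) :> R by rewrite mulrC divfK// gt_eqF.
  have l1 : T%:R * (x - (L + 1) * h T) <= i%:R.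
    by rewrite E1 ler_pM2l//; clear - w1; lra.
  have l2 : i%:R <= T%:R * (x - (L + 1) * h T) + 2 * (L + 1) * N.
    rewrite {1}E1 (_ : _ + _ = T%:R * (x + (L + 1) * h T)); last by rewrite /N; ring.
    by rewrite ler_pM2l//; clear - w2; lra.
  apply/andP; split; first by rewrite truncn_le_nat (le_lt_trans l1)// ltr_nat.
  rewrite -(ltr_nat R); apply: le_lt_trans l2 _.
  rewrite /Nw -addSnnS natrD; apply: ltrD; exact: truncnS_gt.
have NwN : Nw%:R <= (2 * L + 4) * N.
  have q0 : 0 <= 2 * (L + 1) * N by rewrite mulr_ge0 ?mulr_ge0 ?addr_ge0// ltW.
  have /andP[t1 _] := truncn_itv q0.
  rewrite /Nw -addn2 natrD; clear - t1 N1; nra.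
have CN1 : 1 <= 2 * L + 4 by clear - L0; lra.
have Wk x i : `|W x i| <= kap by rewrite /W; case: ifP => _; rewrite ?normr1 ?normr0// ltW.
have ck x i : `|cc x i| <= kap by rewrite /cc; exact: Kk.
have ccout x i : (1 <= i <= T)%N -> ~~ (i0 x <= i < i0 x + Nw)%N -> cc x i = 0.
  by move=> iT ni; apply: Kout; apply: lt_trans (win x i iT ni); rewrite ltrDl.
have Wout x i : (1 <= i <= T)%N -> ~~ (i0 x <= i < i0 x + Nw)%N -> W x i = 0.
  by move=> iT ni; rewrite /W leNgt (win x i iT ni).
have PA3 p : Pr (A3 p) <= 4 * pb.
  have [Tg gD] := Sctr p.2.
  apply: (window_concentration (tau := tau) (a := a) (nu := nu) (Lam := Lam) (C1 := C1) (N := N) (i0 := i0 (X p.1)) (Nw := Nw)) => //.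
  - by move=> i; exact: meps.
  - by move=> i iT; case: (mom' i _ iT (Sctr p.2)).
  - by move=> i iT; case: (mom' i _ iT (Sctr p.2)).
  - by move=> k k0; exact: mixA.
  - exact: ccout.
have PA4 p : Pr (A4 p) <= 4 * pb.
  have [Tg gD] := Sctr p.2.
  apply: (window_concentration (tau := tau) (a := a) (nu := nu) (Lam := Lam) (C1 := C1) (N := N) (phi := fun y => `|phi y|) (i0 := i0 (X p.1)) (Nw := Nw)) => //.
  - by move=> i; exact: meps.
  - by move=> i iT; case: (mom' i _ iT (Sctr p.2)).
  - by move=> i iT; case: (mom' i _ iT (Sctr p.2)).
  - by move=> k k0; exact: mixA.
  - by move=> y; rewrite normr_id.
  - by move=> y; rewrite normr_id.
  - exact: Wout.
have nxH : nx%:R <= 2 * H.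
  have /andP[t1 _] := truncn_itv (ltW H0); rewrite /nx -HE -natr1; clear - t1 H1; lra.
have JH : J%:R <= (2 * m%:R + 3) * D * H.
  apply: le_trans Jb _; rewrite -HE (_ : (2 * m%:R + 3) * D * H = 2 * D * m.+1%:R * H + D * H); last first.
    by rewrite -[m.+1%:R]natr1; ring.
  by rewrite lerD2l -[leLHS]mulr1 ler_pM.
have PA5 : Pr A5 <= grid_const m H D * (8 * pb).
  apply: le_trans (Pr_bigU _ _ _) _; first by move=> p; exact: measurableU.
  apply: (@le_trans _ _ (\sum_(p : 'I_nx * {ffun 'I_m -> 'I_J}) 8 * pb)).
    apply: ler_sum => p _; apply: le_trans (PrU _ _ _) _ => //.
    by rewrite (_ : 8 * pb = 4 * pb + 4 * pb); [exact: lerD|ring].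
  rewrite sumr_const card_prod card_ord card_ffun !card_ord -[_ *+ _]mulr_natl.
  rewrite ler_wpM2r ?mulr_ge0// natrM natrX /grid_const; apply: ler_pM => //.
  by apply: lerXn2r; rewrite ?nnegrE// (le_trans _ JH).
have PA0 : Pr A0' = 0.
  apply/eqP; rewrite eq_le Pr_ge0 andbT; apply: le_trans (Pr_bigU _ _ _) _.
    by move=> i; case: (HN i).
  by rewrite big1// => i _; rewrite /Pr; case: (HN i) => _ ->.
apply: (@outerP_le (A0' `|` (A1 `|` A2) `|` A5)).
- by apply: measurableU => //; apply: measurableU => //; exact: measurableU.
- move=> w /= bad; apply: contrapT => /not_orP[/not_orP[nA0 /not_orP[nA1 nA2]] nA5].
  move: bad; apply/negP; rewrite -leNgt; apply: ge_ereal_sup => _ [[x g] [/= x01 Sg] <-].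
  rewrite lee_fin.
  have [k gk] := cov g Sg.
  have [l xl] := line_cover ha0 (x := x) x01.
  have nN i : (1 <= i <= T)%N -> ~ Nl i w.
    move=> iT Ni; apply: nA0; rewrite /A0' -bigcup_seq; exists i => //=.
    by rewrite mem_index_iota ltnS.
  have nA34 : ~ (A3 (l, k) `|` A4 (l, k)) w.
    move=> H34; apply: nA5; rewrite /A5 -bigcup_seq; exists (l, k) => //=.
    by rewrite mem_index_enum.
  move: nA34 => /not_orP[/negP nA3 /negP nA4].
  rewrite -ltNge in nA3; rewrite -ltNge in nA4.
  rewrite [(l, k).1]/= [(l, k).2]/= in nA3 nA4.
  set gk' := ctr k in gk nA3 nA4.
  have Sk : S gk' by exact: Sctr.
  have [Tg gD] := Sg; have [Tk kD] := Sk.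
  have PsiE g' w' : Psi_hat eps K h j T x g' w' = N^-1 * \sum_(1 <= i < T.+1) cc x i * eps T i g' w'.
    rewrite /Psi_hat !mulr_sumr; apply: eq_bigr => i _; rewrite /cc /N.
    by move: (K _) (_ ^+ j) => ? ?; field; rewrite !gt_eqF.
  have EPsiE : EPsi_hat P eps K h j T x g = N^-1 * \sum_(1 <= i < T.+1) cc x i * E (eps T i g).
    transitivity (E (fun w => N^-1 * \sum_(1 <= i < T.+1) cc x i * eps T i g w)).
      by apply: eqE => w'; exact: PsiE.
    have Lc i : (1 <= i <= T)%N -> L1 (fun w => cc x i * eps T i g w).
      by move=> iT; apply: L1Z; case: (mom' i g iT Sg).
    rewrite EZ; last exact: L1_sum_nat.
    rewrite (E_sum_nat Lc); congr (_ * _); apply: eq_big_nat => i; rewrite ltnS => iT.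
    by rewrite EZ//; case: (mom' i g iT Sg).
  rewrite PsiE EPsiE -mulrBr -sumrB.
  under eq_bigr do rewrite -mulrBr.
  rewrite normrM gtr0_norm ?invr_gt0// ler_pdivrMl//.
  set V := \sum_(1 <= i < T.+1) _.
  have taus : tau `^ (1 - s) = h T * a.
    rewrite tauE -powRrM (_ : (s - 1)^-1 * (1 - s) = -1); last by field; rewrite gt_eqF ?subr_gt0 ?(lt_trans _ s2)// ltr1n.
    by rewrite powR_inv1 ?ltW// HE invrK.
  have tail (y : R) : `|y - phi y| <= h T * a * `|y| `^ s.
    rewrite /phi; case: ifPn => [_|]; first by rewrite subrr normr0 mulr_ge0 ?powR_ge0// ltW.
    rewrite -ltNge => /ltW ty; rewrite subr0 -taus -{1}[`|y|]powRr1//.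
    by apply: powR_tail; rewrite ?tau0.
  set Vk := \sum_(1 <= i < T.+1) cc x i * (eps T i gk' w - E (eps T i gk')).
  pose ephi i := E (fun w => phi (eps T i gk' w)).
  set Vp := \sum_(1 <= i < T.+1) cc x i * (phi (eps T i gk' w) - ephi i).
  set Vl := \sum_(1 <= i < T.+1) cc (X l) i * (phi (eps T i gk' w) - ephi i) in nA3.
  have B1 : `|V - Vk| <= kap * (h T * a) *
      (\sum_(1 <= i < T.+1) xi T i gk' w + \sum_(1 <= i < T.+1) E (xi T i gk')).
    (* a <= 1 keeps the mesh within the radius [h T] on which the Lipschitz condition holds. *)
    have hah : h T * a <= h T by rewrite ler_piMr// ltW.
    have dif i w' : (1 <= i <= T)%N -> ~ Nl i w' -> `|eps T i g w' - eps T i gk' w'| <= h T * a * xi T i gk' w'.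
      move=> iT nNi; have [_ _ HNi] := HN i.
      apply: le_trans (HNi iT w' nNi gk' g Tk Tg (le_trans gk hah)) _.
      by rewrite mulrC ler_wpM2r.
    apply: (weighted_diff (ck x)) => i iT; first by apply: dif => //; exact: nN.
    have [_ _ le1 _ _] := mom' i g iT Sg; have [_ _ le2 _ [lx _]] := mom' i gk' iT Sk.
    rewrite -EB// -EZ//; have [mN PN _] := HN i.
    by apply: (E_ae_le (N := Nl i)) => //; [exact: L1B|exact: L1Z|move=> w' nw; exact: dif].
  have B2 : `|Vk - Vp| <= kap * (h T * a) *
      (\sum_(1 <= i < T.+1) `|eps T i gk' w| `^ s + \sum_(1 <= i < T.+1) E (fun w => `|eps T i gk' w| `^ s)).
    apply: (weighted_diff (ck x)) => i iT; first exact: tail.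
    have [ls _ le _ _] := mom' i gk' iT Sk.
    have lp : L1 (fun w => phi (eps T i gk' w)).
      by apply: (@L1_bounded _ _ _ _ _ tau) => //; apply: measurableT_comp => //; exact: meps.
    by rewrite /ephi -EB// -EZ//; apply: E_abs_le; [exact: L1B|exact: L1Z|move=> w'; exact: tail].
  have ccW i : `|cc x i - cc (X l) i| <= kap * a * W (X l) i.
    rewrite /W; case: ifPn => [_|].
      rewrite mulr1 /cc; apply: le_trans (KLip _ _) _; rewrite ler_wpM2l ?(ltW kap0)//.
      rewrite -mulrBl normrM [`|(h T)^-1|]gtr0_norm ?invr_gt0// ler_pdivrMr//.
      rewrite (_ : _ - x - _ = X l - x); last by ring.
      by rewrite distrC mulrC.
    (* Where [W] vanishes, both arguments lie outside the support of the kernel, so both weights are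
       0. *)
    rewrite -ltNge => Wl; rewrite /cc Kout; last first.
      have : `|(i%:R / T%:R - X l) / h T - (i%:R / T%:R - x) / h T| <= 1.
        rewrite -mulrBl normrM [`|(h T)^-1|]gtr0_norm ?invr_gt0// ler_pdivrMr// mul1r.
        rewrite (_ : _ - X l - _ = x - X l); last by ring.
        by apply: le_trans xl _; rewrite ler_piMr// ltW.
      by move=> /lt_normr_dist; apply.
    by rewrite Kout; [rewrite subrr normr0 mulr0|apply: lt_trans Wl; rewrite ltrDl].
  have SW : \sum_(1 <= i < T.+1) W (X l) i <= (2 * L + 4) * N.
    apply: le_trans NwN; rewrite (@big_window _ _ _ (i0 (X l)) Nw); last by move=> i; exact: Wout.
    rewrite -[Nw in X in _ <= X]card_ord -sum1_card natr_sum; apply: ler_sum => i _.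
    by rewrite /W; case: ifP => _; [case: ifP|].
  pose e := 1 + C1 * (1 + Lam).
  have B3 : `|Vp - Vl| <= kap * a * (M1 * Lam * a * N + 2 * e * ((2 * L + 4) * N)).
    have lp i : L1 (fun w => phi (eps T i gk' w)).
      by apply: (@L1_bounded _ _ _ _ _ tau) => //; apply: measurableT_comp => //; exact: meps.
    have ka0 : 0 <= kap * a by rewrite mulr_ge0// ltW.
    have W0 i : 0 <= W (X l) i by rewrite /W; case: ifP.
    have ezaz i : `|ephi i| <= E (fun w => `|phi (eps T i gk' w)|) by exact: E_abs.
    have aze i : (1 <= i <= T)%N -> E (fun w => `|phi (eps T i gk' w)|) <= e.
      move=> iT; have [_ _ le le' _] := mom' i gk' iT Sk; apply: le_trans le'.
      by apply: E_le => //; exact: L1_abs.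
    have := weight_change (fun i => phi (eps T i gk' w)) ka0 ccW W0 ezaz aze.
    move=> /le_trans; apply.
    have e0 : 0 <= 2 * e by rewrite mulr_ge0// addr_ge0// mulr_ge0 ?addr_ge0// ltW.
    apply: ler_wpM2l; first by rewrite mulr_ge0// ltW.
    by apply: lerD; [exact: ltW|exact: ler_wpM2l].
  have TT : \sum_(1 <= i < T.+1) (1 : R) = T%:R by rewrite sumr_const_nat subn1.
  have Sx : \sum_(1 <= i < T.+1) xi T i gk' w <= T%:R * (1 + M * Lam).
    apply: (@le_trans _ _ (\sum_(1 <= i < T.+1) (1 + `|xi T i gk' w| `^ s))).
      by apply: ler_sum => i _; apply: le_trans (abs_le_1powR _ s1); rewrite ler_norm.
    rewrite big_split/= TT mulrDr mulr1 lerD2l; apply: (HA2 w nA2) => i iT.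
    by apply: ereal_sup_ubound; exists gk'.
  have Se : \sum_(1 <= i < T.+1) `|eps T i gk' w| `^ s <= T%:R * (M * Lam).
    by apply: (HA1 w nA1) => i iT; apply: ereal_sup_ubound; exists gk'.
  have SEx : \sum_(1 <= i < T.+1) E (xi T i gk') <= T%:R * (1 + C2 * (1 + Lam)).
    rewrite -TT mulr_suml big_nat_cond [leRHS]big_nat_cond; apply: ler_sum => i /andP[iT _].
    by rewrite mul1r; case: (mom' i gk' iT Sk) => _ _ _ _ [].
  have SEe : \sum_(1 <= i < T.+1) E (fun w => `|eps T i gk' w| `^ s) <= T%:R * (C1 * (1 + Lam)).
    rewrite -TT mulr_suml big_nat_cond [leRHS]big_nat_cond; apply: ler_sum => i /andP[iT _].
    by rewrite mul1r; case: (mom' i gk' iT Sk).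
  have kh0 : 0 <= kap * (h T * a) by rewrite mulr_ge0// ltW.
  have {}B1 := le_trans B1 (ler_wpM2l kh0 (lerD Sx SEx)).
  have {}B2 := le_trans B2 (ler_wpM2l kh0 (lerD Se SEe)).
  have V4 : `|V| <= `|V - Vk| + `|Vk - Vp| + `|Vp - Vl| + `|Vl|.
    exact: normr_chain.
  apply: le_trans V4 _; apply: le_trans (lerD (lerD (lerD B1 B2) B3) (ltW nA3)) _.
  rewrite /dev_const /e.
  (* Each term is absorbed in its share of [dev_const] through Lam >= 1 and a <= 1. *)
  have i1 : 2 + 2 * (M * Lam) + (C2 + C1) * (1 + Lam) <= (2 + 2 * M + 2 * C2 + 2 * C1) * Lam.
    by clear - Lam1 M0 C10 C20; nra.
  have i2 : M1 * Lam * a <= M1 * Lam by rewrite ler_piMr// mulr_ge0// ltW.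
  have i3 : 2 * (1 + C1 * (1 + Lam)) * (2 * L + 4) <= 2 * (1 + 2 * C1) * (2 * L + 4) * Lam.
    by rewrite [leRHS]mulrAC ler_wpM2r//; clear - L0 Lam1 C10; nra.
  have aN0 : 0 <= a * N by rewrite mulr_ge0// ltW.
  set lhs := (X in X <= _).
  have -> : lhs = a * N * (kap * (2 + 2 * (M * Lam) + (C2 + C1) * (1 + Lam)) +
      kap * (M1 * Lam * a + 2 * (1 + C1 * (1 + Lam)) * (2 * L + 4)) + M1 * Lam).
    by rewrite /lhs /N; ring.
  rewrite (_ : N * _ = a * N * (kap * ((2 + 2 * M + 2 * C2 + 2 * C1) * Lam) +
      kap * (M1 * Lam + 2 * (1 + 2 * C1) * (2 * L + 4) * Lam) + M1 * Lam)); last by ring.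
  apply: ler_wpM2l => //; rewrite lerD2r; apply: lerD; (apply: ler_wpM2l; first exact: ltW) => //.
  exact: lerD.
- have Cb : (C * (1 + Lam) + 1) / (M * Lam) <= (2 * C + 1) / M.
    rewrite ler_pdivrMr// mulrA divfK ?gt_eqF//; clear - C0 Lam1; nra.
  apply: le_trans (PrU _ _ _) _ => //; first by apply: measurableU => //; exact: measurableU.
  apply: lerD => //.
  apply: le_trans (PrU _ _ _) _ => //; first exact: measurableU.
  rewrite PA0 add0r; apply: le_trans (PrU _ _ _) _ => //.
  by rewrite mulr_natl mulr2n; apply: lerD; [apply: le_trans PA1 _|apply: le_trans PA2 _].
Qed.
End fixedT.

(** * Choice of constants and conclusion *)

Section rate_bounds.
Context {R : realType}.

Lemma theta_of_le1 (beta s c : R) m : 2 < s -> 0 < beta -> 0 < c -> theta_of beta m s c <= 1.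
Proof.
move=> s2 b0 c0; rewrite /theta_of.
have q0 : 0 <= m%:R * (s - 1) :> R by rewrite mulr_ge0// subr_ge0 ltW// (lt_trans _ s2)// ltr1n.
have q1 : 0 <= m%:R * (s - 1) * c by rewrite mulr_ge0// ltW.
have bs : 0 < beta * s by nra.
rewrite ler_pdivrMr; last by lra.
by nra.
Qed.

Lemma r_of_bounds (theta lam c : R) : theta <= 1 -> 0 <= lam -> 0 < c -> 0 <= r_of theta lam c <= c.
Proof.
move=> th1 lam0 c0; rewrite /r_of; case: eqP => _; first by rewrite lexx ltW.
by rewrite ge_min lexx orTb andbT le_min (ltW c0)/= divr_ge0 ?subr_ge0// mulr_ge0.
Qed.

Lemma grid_const_le (m : nat) (H D T c : R) : 0 <= H -> 0 <= D -> 0 <= T -> D <= T `^ c ->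
  grid_const m H D <= 2 * (2 * m%:R + 3) ^+ m * (T `^ (c * m%:R) * H ^+ m.+1).
Proof.
move=> H0 D0 T0 DT; have m0 : 0 <= 2 * m%:R + 3 :> R by rewrite addr_ge0 ?mulr_ge0.
rewrite /grid_const powRrM powR_mulrn ?powR_ge0//.
have -> : 2 * (2 * m%:R + 3) ^+ m * ((T `^ c) ^+ m * H ^+ m.+1) =
   2 * H * ((2 * m%:R + 3) * T `^ c * H) ^+ m by rewrite !exprMn exprS; ring.
apply: ler_wpM2l; first by rewrite mulr_ge0.
apply: lerXn2r; rewrite ?nnegrE ?mulr_ge0 ?powR_ge0//.
by rewrite ler_wpM2r// ler_wpM2l.
Qed.

(** [delta] is shared out: a quarter to the Markov sets by the choice of [Mk], half to the
    exponential tail, a quarter to the mixing term. [M1] makes the tail T to the power -(c m + m +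
    2); against a number of grid points of order T^(c m + m + 1) this leaves 1/T. *)
Lemma total_probability_bound (m : nat) (h T ell delta beta c D H nu w Cv Cm kap M1 Mk C : R) :
  0 < delta -> 1 < T -> ell = ln T -> 0 < C -> 0 <= Cm -> 0 < kap -> 0 <= H -> H <= T -> 0 <= D ->
  D <= T `^ c -> 0 <= T * h ->
  Mk = 8 * (2 * C + 1) / delta -> M1 = 8 * kap * (Cv + (c * m%:R + m%:R + 2)) ->
  (T `^ (c * m%:R) * H ^+ m.+1) * (T * h * nu `^ (- (1 + beta))) <= w ->
  16 * (2 * (2 * m%:R + 3) ^+ m) <= delta * T ->
  32 * (2 * (2 * m%:R + 3) ^+ m) * Cm * w <= delta ->
  2 * ((2 * C + 1) / Mk) + grid_const m H D *
     (8 * (expR ((Cv - M1 / (8 * kap)) * ell) + Cm * (T * h * nu `^ (- (1 + beta))))) <= delta.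
Proof.
move=> d0 T1 lE C0 Cm0 k0 H0 HT D0 DT N0 MkE M1E Qw T16 w32.
have T0 : 0 < T by lra.
have c21 : 0 < 2 * C + 1 by lra.
have E1 : 2 * ((2 * C + 1) / Mk) = delta / 4.
  by rewrite MkE; field; rewrite !gt_eqF.
set G := 2 * (2 * m%:R + 3) ^+ m in T16 w32.
have G0 : 0 <= G by rewrite mulr_ge0// exprn_ge0// addr_ge0 ?mulr_ge0.
have gG := grid_const_le m H0 D0 (ltW T0) DT; rewrite -/G in gG.
set Z := T `^ (c * m%:R) * H ^+ m.+1 in gG Qw.
have Z0 : 0 <= Z by rewrite mulr_ge0 ?powR_ge0 ?exprn_ge0.
have X1 : expR ((Cv - M1 / (8 * kap)) * ell) = T `^ (- (c * m%:R + m%:R + 2)).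
  rewrite /powR gt_eqF// -lE M1E; congr expR.
  by rewrite mulrAC divff ?mul1r ?gt_eqF ?mulr_gt0//; ring.
have X2 : Z * T `^ (- (c * m%:R + m%:R + 2)) <= T^-1.
  apply: (@le_trans _ _ (T `^ (c * m%:R) * T `^ (m.+1%:R) * T `^ (- (c * m%:R + m%:R + 2)))).
    rewrite ler_wpM2r ?powR_ge0// ler_wpM2l ?powR_ge0// (powR_mulrn _ (ltW T0)).
    by apply: lerXn2r; rewrite ?nnegrE// ltW.
  rewrite -!powR_addp// -[m.+1%:R]natr1 (_ : _ + _ = -1); last by ring.
  by rewrite powR_inv1// ltW.
rewrite X1 E1; set e := T `^ _ in X2 *; set n' := T * h * _ in Qw *.
have e0 : 0 <= e by exact: powR_ge0.
have n0 : 0 <= n' by rewrite mulr_ge0 ?powR_ge0.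
apply: (@le_trans _ _ (delta / 4 + G * Z * (8 * (e + Cm * n')))).
  rewrite lerD2l ler_wpM2r// mulr_ge0// addr_ge0// mulr_ge0//.
rewrite (_ : G * Z * _ = 8 * G * (Z * e) + 8 * G * Cm * (Z * n')); last by ring.
have i1 : 8 * G * (Z * e) <= delta / 2.
  apply: (@le_trans _ _ (8 * G * T^-1)); first by rewrite ler_wpM2l// mulr_ge0.
  by rewrite ler_pdivrMr//; clear - T16; lra.
have i2 : 8 * G * Cm * (Z * n') <= delta / 4.
  apply: (@le_trans _ _ (8 * G * Cm * w)); first by rewrite ler_wpM2l// !mulr_ge0.
  by clear - w32; lra.
by clear - i1 i2; lra.
Qed.

End rate_bounds.

Theorem theorem1 (R : realType) (d : measure_display) (Omega : measurableType d)
  (P : probability Omega R) (m : nat) (Theta : set 'rV[R]_m)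
  (eps xi : nat -> nat -> 'rV[R]_m -> Omega -> R)
  (h : nat -> R) (K : R -> R) (j : nat) (s beta lam c : R) :
  (* random variables *)
  (forall T i g, Theta g -> measurable_fun setT (eps T i g)) ->
  (* bandwidth *)
  (forall T, 0 < h T) ->
  h @ \oo --> 0 ->
  (forall M : R, \forall T \near \oo, M < T%:R * h T) ->
  2 < s ->
  (* (A.1) *)
  2 < beta ->
  (exists A : R, 0 < A /\ forall (i T : nat) g, (1 <= i)%N -> (1 <= T)%N -> Theta g ->
      mixing_coef P eps T g i <= A * (i%:R `^ (- beta))) ->
  (* (A.2) *)
  (exists Kbar mubar Lam1 L1 : R, 1 <= Lam1 /\ 1 <= L1 /\
      (forall u, `|K u| <= Kbar) /\
      (\int[lebesgue_measure]_u ((`|K u| `^ s)%:E) <= mubar%:E)%E /\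
      (forall u, L1 < `|u| -> K u = 0) /\
      (forall u u', `|K u - K u'| <= Lam1 * `|u - u'|)) ->
  (* (A.3) *)
  0 <= lam ->
  (forall T i g, Theta g -> measurable_fun setT (xi T i g)) ->
  (forall T i g w, 0 <= xi T i g w) ->
  (forall T i, (1 <= T)%N -> (1 <= i <= T)%N ->
     {ae P, forall w, forall g g', Theta g -> Theta g' -> enorm (g' - g) <= h T ->
        `|eps T i g' w - eps T i g w| <= xi T i g w * enorm (g' - g)}) ->
  (exists C1 C2 : R, 0 < C1 /\ 0 < C2 /\
     forall T i g, (1 <= T)%N -> (1 <= i <= T)%N -> Theta g ->
       (\int[P]_w ((`|eps T i g w| `^ s)%:E) <= (C1 * (1 + enorm g `^ lam))%:E)%E /\
       (\int[P]_w ((`|xi T i g w| `^ s)%:E) <= (C2 * (1 + enorm g `^ lam))%:E)%E) ->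
  (* the theorem's own assumptions *)
  0 < c ->
  let theta := theta_of beta m s c in
  let dT := fun T : nat => T%:R `^ r_of theta lam c in
  let ThetaT := fun T : nat => [set g | Theta g /\ enorm g <= dT T] in
  (m%:R * (s - 1) * (1 + 2 * c) + 2 * s - 1) / (s - 2) < beta ->
  (fun T : nat => ln T%:R / (T%:R `^ theta * h T)) @ \oo --> 0 ->
  (exists C : R, 0 < C /\ forall T i, (1 <= T)%N -> (1 <= i <= T)%N ->
     (outerE P (fun w => ereal_sup [set (`|eps T i g w| `^ s)%:E | g in ThetaT T])
        <= (C * (1 + dT T `^ lam))%:E)%E /\
     (outerE P (fun w => ereal_sup [set (`|xi T i g w| `^ s)%:E | g in ThetaT T])
        <= (C * (1 + dT T `^ lam))%:E)%E) ->
  (* conclusion: O_p rate *)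
  forall delta : R, 0 < delta -> exists M : R, \forall T \near \oo,
    (outerP P [set w | ((M * (dT T `^ lam * Num.sqrt (ln T%:R / (T%:R * h T))))%:E <
        ereal_sup [set (`| Psi_hat eps K h j T z.1 z.2 w - EPsi_hat P eps K h j T z.1 z.2 |)%:E
                  | z in (`[0%R, 1%R]%classic : set R) `*` ThetaT T])%E]
      <= delta%:E)%E.
Proof.
move=> meps h0 hcvg Thcvg s2 beta2 [A [A0 mixA]] [Kbar [mubar [Lam1 [L [_ [L1' [Kb [_ [Kout KLip]]]]]]]]].
move=> lam0 mxi xi0 aeLip [C1 [C2 [C10 [C20 mom]]]] c0 theta dT ThetaT betaL wcvg [C [C0 out]] delta delta0.
have [kap kap1 [Kk Kout' KLip']] := kernel_moment j L1' Kb Kout KLip.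
have kap0 : 0 < kap by exact: lt_le_trans kap1.
have beta0 : 0 < beta by exact: lt_trans beta2.
have th1 : theta <= 1 by exact: theta_of_le1.
have /andP[r0 rc] := r_of_bounds th1 lam0 c0.
have s20 : 0 < s - 2 by rewrite subr_gt0.
(* The lower bound on beta gives beta (s - 2) > 2 s - 1, which is at least 3 s / 2 for s > 2. *)
have rho : 3 / 2 * s <= beta * (s - 2).
  move: betaL; rewrite ltr_pdivrMr// => betaL.
  have q1 : 0 <= m%:R * (s - 1) * (1 + 2 * c).
    have p1 : 0 <= s - 1 by clear - s2; lra.
    have p2 : 0 <= 1 + 2 * c by clear - c0; lra.
    by rewrite mulr_ge0// mulr_ge0.
  by clear - q1 betaL s2; lra.
pose Cv := var_const A kap s C1 (2 * L + 4).
pose Cm := mix_const A (2 * L + 4) beta.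
pose Mk := 8 * (2 * C + 1) / delta.
pose M1 := 8 * kap * (Cv + (c * m%:R + m%:R + 2)).
pose G : R := 2 * (2 * m%:R + 3) ^+ m.
have L0 : 0 < L by exact: lt_le_trans L1'.
have Cv0 : 0 <= Cv.
  have p1 : 0 <= 2 * L + 4 + 1 by clear - L0; lra.
  apply: mulr_ge0 => //; apply: mulr_ge0 => //; apply: addr_ge0; apply: mulr_ge0 => //.
    exact: ltW.
  exact: sqr_ge0.
have Cm0 : 0 <= Cm.
  have p1 : 0 <= 2 * L + 4 + 1 by clear - L0; lra.
  apply: mulr_ge0; last exact: powR_ge0.
  by apply: mulr_ge0 => //; apply: mulr_ge0 => //; exact: ltW.
have G0 : 0 <= G by rewrite mulr_ge0// exprn_ge0// addr_ge0 ?mulr_ge0.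
have M10 : 0 <= M1.
  apply: mulr_ge0; first by apply: mulr_ge0 => //; exact: ltW.
  apply: addr_ge0 => //; apply: addr_ge0 => //; apply: addr_ge0 => //.
  by apply: mulr_ge0 => //; exact: ltW.
have Mk0 : 0 < Mk by rewrite divr_gt0// mulr_gt0// addr_gt0// mulr_gt0.
exists (dev_const kap Mk M1 C1 C2 L).
(* [v] is the mixing term that [delta] tolerates, and [w0] a bound on ln T / (T^theta h) whose power
   beta / 2 is at most [v]. *)
pose v := delta / (32 * G * Cm + 1).
have q0 : 0 < 32 * G * Cm + 1 by apply: ltr_wpDl => //; apply: mulr_ge0 => //; exact: mulr_ge0.
have v0 : 0 < v by rewrite divr_gt0.
pose w0 := Num.min 1 (v `^ (2 / beta)).
have w00 : 0 < w0 by rewrite lt_min ltr01 powR_gt0.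
near=> T.
have T1n : (0 < T)%N by near: T; exact: nbhs_infty_gt.
(* T >= e makes ln T at least 1, as the rate computations assume. *)
have Te : expR 1 <= T%:R :> R by near: T; exact: nbhs_infty_ger.
have TG : 16 * G / delta <= T%:R by near: T; exact: nbhs_infty_ger.
have N1 : 1 < T%:R * h T by near: T; exact: Thcvg.
have h1 : h T <= 1.
  near: T; have := cvgr_le _ hcvg; apply; exact: ltr01.
have ww : ln T%:R / (T%:R `^ theta * h T) <= w0.
  near: T; have := cvgr_le _ wcvg; apply; exact: w00.
have T1 : 1 < T%:R :> R by apply: lt_le_trans Te; rewrite expR_gt1.
have T0 : 0 < T%:R :> R by apply: lt_trans T1.
have l1 : 1 <= ln T%:R :> R by rewrite -[leLHS](expRK 1) ler_ln ?posrE ?expR_gt0.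
have w1 : ln T%:R / (T%:R `^ theta * h T) <= 1 by apply: le_trans ww _; rewrite ge_min lexx.
have thE : theta = theta_of beta m s c by [].
have [[a0 a1 H1 HT] [tau1 nu1 nuN] Q] :=
  rate_facts s2 beta2 c0 thE th1 (h0 T) h1 (ltW T1) (ltW N1) l1 (erefl _) w1.
set a := Num.sqrt _ in a0 a1 H1 HT tau1 nu1 nuN Q.
set H := (h T * a)^-1 in H1 HT tau1 nu1 nuN Q.
set tau := H `^ _ in tau1 nu1 nuN Q.
set nu := (a * tau)^-1 in nu1 nuN Q.
have N0 : 0 < T%:R * h T by rewrite mulr_gt0.
have tau0 : 0 < tau by apply: lt_le_trans tau1.
have D1 : 1 <= dT T by rewrite /dT -[leLHS](powRr0 T%:R) ler_powR// ltW.
have D0 : 0 <= dT T by apply: le_trans D1.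
have Lam1' : 1 <= dT T `^ lam by rewrite -[leLHS](powRr0 (dT T)) ler_powR.
apply: le_trans (uniform_deviation_outerP (A := A) (beta := beta) (C := C) (tau := tau) (nu := nu)
   (H := H) (ell := ln T%:R) T1n (meps T) (mxi T) (xi0 T) (fun i => aeLip T i T1n) _ _
   (out T ^~ T1n) kap1 L1' Kk Kout' KLip' A0 s2 rho C10 C20 C0 Lam1' D1 (h0 T) (ltW N1)
   a0 a1 (erefl _) H1 (erefl _) tau0 nu1 nuN _ _ Mk0 M10) _.
- move=> i g iT Tg gD; have [m1 m2] := mom T i g T1n iT Tg.
  have e : enorm g `^ lam <= dT T `^ lam.
    by apply: ge0_ler_powR; rewrite ?nnegrE// sqrtr_ge0.
  split; [apply: le_trans m1 _|apply: le_trans m2 _]; rewrite lee_fin.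
    by rewrite ler_pM2l// lerD2l.
  by rewrite ler_pM2l// lerD2l.
- by move=> k g k0 Tg; exact: mixA.
- by rewrite /nu mulfV// gt_eqF// mulr_gt0.
- rewrite /a sqr_sqrtr; last by apply: divr_ge0; [exact: le_trans l1|exact: ltW].
  by rewrite divfK// gt_eqF.
rewrite lee_fin; apply: (total_probability_bound (T := T%:R) (c := c)
  (w := v)) => //; try exact: ltW.
- by rewrite invr_ge0; apply: mulr_ge0; exact: ltW.
- by rewrite /dT ler_powR// ltW.
- apply: le_trans Q _.
  have wpos : 0 <= ln T%:R / (T%:R `^ theta * h T).
    apply: divr_ge0; first exact: le_trans l1.
    by apply: mulr_ge0; [exact: powR_ge0|exact: ltW].
  apply: (@le_trans _ _ ((v `^ (2 / beta)) `^ (beta / 2))).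
    apply: ge0_ler_powR; rewrite ?nnegrE ?powR_ge0//; first by rewrite divr_ge0// ltW.
    by apply: le_trans ww _; rewrite ge_min lexx orbT.
  rewrite -powRrM (_ : 2 / beta * (beta / 2) = 1); last by field; rewrite gt_eqF.
  by rewrite powRr1// ltW.
- by move: TG; rewrite ler_pdivrMr// [T%:R * delta]mulrC.
- rewrite -/G -/Cm; apply: (@le_trans _ _ ((32 * G * Cm + 1) * v)).
    by rewrite ler_wpM2r ?(ltW v0)// lerDl.
  by rewrite /v mulrC divfK// gt_eqF.
Unshelve. all: by end_near.
Qed.
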